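(* Let $n\ge2$, $p\ge 1$, let $v^1,\dots,v^p$ be distinct points of $\mathbb{TP}^{n-1}$ in general position, and assume that the tropical polytope $\mathcal{P}$ generated by $v^1,\dots,v^p$ is pure. Then, for any lift $\boldsymbol{P}$ of $\mathcal{P}$, the images under the valuation map of the facet-defining half-spaces of $\boldsymbol{P}$ provide an external representation of $\mathcal{P}$ by tropical half-spaces. More precisely, this external representation contains all the half-spaces $\mathcal{H}(a,I)$ associated with the $(I,j)$-pseudovertices $a$ of $\mathcal{P}$ (for all non-empty proper subsets $I$ of $\{1,\dots,n\}$ and all $j\in\{1,\dots,n\}\setminus I$).
   Context: Tropical projective space: $\mathbb{TP}^{n-1} = \mathbb{R}^n/\mathbb{R}(1,\dots,1)$, with the topology induced by the usual topology of $\mathbb{R}^n$. The tropical polytope generated by $v^1,\dots,v^p\in\mathbb{TP}^{n-1}$ is the set of all $x\in\mathbb{TP}^{n-1}$ (represented in $\mathbb{R}^n$) of the form $x_i=\max_{1\le r\le p}(\lambda_r+v^r_i)$ for $i=1,\dots,n$, with $\lambda_1,\dots,\lambda_p\in\mathbb{R}$. It is pure if it equals the closure of its interior in $\mathbb{TP}^{n-1}$. For $a\in\mathbb{TP}^{n-1}$ and a non-empty proper subset $I\subset\{1,\dots,n\}$, the tropical half-space with apex $a$ is $\mathcal{H}(a,I)=\{x\in\mathbb{TP}^{n-1}\mid\max_{i\in I}(x_i-a_i)\ge\max_{j\notin I}(x_j-a_j)\}$. An external representation of $\mathcal{P}$ is a finite set of tropical half-spaces whose intersection is $\mathcal{P}$.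 Types and $(I,j)$-pseudovertices: for $a\in\mathbb{TP}^{n-1}$ and $i\in\{1,\dots,n\}$ let $S_i(a)=\{r\in\{1,\dots,p\}\mid v^r_i-a_i\ge v^r_k-a_k\text{ for all }k\in\{1,\dots,n\}\}$. Given a non-empty proper subset $I$ of $\{1,\dots,n\}$ and $j\in\{1,\dots,n\}\setminus I$, a point $a\in \mathbb{TP}^{n-1}$ is an $(I,j)$-pseudovertex of $\mathcal{P}$ if: (i) $\bigcup_{i\in I}S_i(a)=\{1,\dots,p\}$; (ii) for each $k\in\{1,\dots,n\}\setminus I$ there exists $i\in I$ with $S_i(a)\cap S_k(a)\ne\emptyset$; (iii) $S_i(a)\cap S_j(a)\not\subseteq\bigcup_{h\in I\setminus\{i\}}S_h(a)$ for all $i\in I$. The half-space associated with such an $a$ is $\mathcal{H}(a,I)$. General position: a square real matrix $U=(u_{ij})$ of size $m$ is tropically singular if the maximum $\max_{\sigma}(u_{1\sigma(1)}+\dots+u_{m\sigma(m)})$ over all permutations $\sigma$ of $\{1,\dots,m\}$ is attained by at least two permutations. Points $v^1,\dots,v^p$ are in general position if every square submatrix of the $n\times p$ matrix with columns $v^1,\dots,v^p$ is tropically non-singular. Hahn series: $\mathbb{K}$ is the field of real Hahn series $\boldsymbol{x}=\sum_{\alpha\in\mathbb{R}}x_\alpha t^\alpha$ ($x_\alpha\in\mathbb{R}$, well-ordered support). For $\boldsymbol{x}\neq 0$, let $\alpha_{\min}(\boldsymbol{x})$ be the least element of the support; $\mathrm{val}(\boldsymbol{x})=-\alpha_{\min}(\boldsymbol{x})$,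 and $\mathrm{val}(0)=-\infty$. $\boldsymbol{x}$ is positive if $x_{\alpha_{\min}(\boldsymbol{x})}>0$; this makes $\mathbb{K}$ a totally ordered field, and $\mathbb{K}^+$ is the set of positive elements. The map $\mathrm{val}$ is applied coordinate-wise to vectors. A lift of $\mathcal{P}$ is any polyhedral cone $\boldsymbol{P}=\mathrm{cone}(\{\boldsymbol{v}^1,\dots,\boldsymbol{v}^p\})\subset\mathbb{K}^n$, where $\boldsymbol{v}^r\in(\mathbb{K}^+)^n$ satisfies $\mathrm{val}(\boldsymbol{v}^r)=v^r$ for each $r$. A facet-defining half-space of $\boldsymbol{P}$ is a half-space $\{\boldsymbol{x}\in\mathbb{K}^n\mid\sum_i\boldsymbol{f}_i\boldsymbol{x}_i\ge0\}$ containing $\boldsymbol{P}$ and whose bounding hyperplane meets $\boldsymbol{P}$ in a facet (a face of dimension $n-1$). The image under the valuation map of a half-space $\boldsymbol{H}$ means the image of $\boldsymbol{H}\cap(\mathbb{K}^+)^n$ under $\mathrm{val}$, regarded in $\mathbb{TP}^{n-1}$. *)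

(* Defs.v *)
From HB Require Import structures.
From mathcomp Require Import all_boot all_order all_algebra perm finmap generic_quotient.
From mathcomp Require Import all_classical all_reals all_analysis.

Set Implicit Arguments.
Unset Strict Implicit.
Unset Printing Implicit Defensive.

Import Order.TTheory GRing.Theory Num.Theory.
Import numFieldNormedType.Exports.

Local Open Scope classical_set_scope.
Local Open Scope ring_scope.

(** * The ordered field of real Hahn series with real exponents *)

Definition well_ordered (R : realType) (A : set R) : Prop :=
  forall S : set R, S `<=` A -> S !=set0 -> exists2 m, S m & lbound S m.

Record hahn (R : realType) : Type := Hahn {
  hcoef :> R -> R;
  _ : well_ordered [set a | hcoef a != 0] }.

Section WellOrdered.
Context {R : realType}.
Implicit Types A B S : set R.

Lemma well_ordered_sub A B : A `<=` B -> well_ordered B -> well_ordered A.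
Proof. by move=> AB wB S SA; apply: wB; exact: subset_trans AB. Qed.

Lemma well_ordered_set1 (a : R) : well_ordered [set a].
Proof.
move=> S Sa [s Ss]; exists s => // t St.
by rewrite (Sa _ Ss) (Sa _ St).
Qed.

Lemma well_orderedU A B :
  well_ordered A -> well_ordered B -> well_ordered (A `|` B).
Proof.
move=> wA wB S SAB S0.
have [SA|/set0P SA] := eqVneq (S `&` A) set0.
  apply: wB => // s Ss; have [As|//] := SAB _ Ss.
  by have : (S `&` A) s by []; rewrite SA.
have [SB|/set0P SB] := eqVneq (S `&` B) set0.
  apply: wA => // s Ss; have [//|Bs] := SAB _ Ss.
  by have : (S `&` B) s by []; rewrite SB.
have [a [Sa Aa] la] := wA (S `&` A) (@subIsetr _ _ _) SA.
have [b [Sb Bb] lb] := wB (S `&` B) (@subIsetr _ _ _) SB.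
have [ab|/ltW ba] := leP a b.
  exists a => // s Ss; have [As|Bs] := SAB _ Ss; first exact: la.
  by apply: le_trans ab _; exact: lb.
exists b => // s Ss; have [As|Bs] := SAB _ Ss; last exact: lb.
by apply: le_trans ba _; exact: la.
Qed.

Definition sumset A B := [set s : R | exists a b, [/\ A a, B b & s = a + b]].

Lemma well_ordered_sumset A B :
  well_ordered A -> well_ordered B -> well_ordered (sumset A B).
Proof.
move=> wA wB.
pose below (Q : R -> Prop) S :=
  forall s, S s -> exists a b, [/\ A a, B b, Q a & s = a + b].
have step Q S : S !=set0 -> below Q S -> exists a s, [/\ A a, Q a, S s &
    below (fun a' => a' < a) (S `&` [set s' | s' < s])].
  move=> [s0 Ss0] bS.
  have [||b [Bb [a0 [Aa0 Qa0 Sa0]]] lb] := wB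
      [set b | B b /\ exists a, [/\ A a, Q a & S (a + b)]].
  - by move=> ? [].
  - have [a [b [Aa Bb Qa s0E]]] := bS _ Ss0.
    by exists b; split=> //; exists a; rewrite -s0E.
  exists a0, (a0 + b); split=> // s [Ss /= sab].
  have [a [b' [Aa Bb' Qa sE]]] := bS _ Ss; exists a, b'; split=> //.
  have bb' : b <= b'.
    by apply: lb; split=> //; exists a; rewrite -sE.
  rewrite ltNge; apply/negP => a0a; move: sab; rewrite sE ltNge => /negP; apply.
  exact: lerD.
have key a0 : A a0 -> forall S, S !=set0 -> below (fun a => a < a0) S ->
    exists2 m, S m & lbound S m.
  apply: contraPP => nk Aa0.
  pose bad := [set a | A a /\ ~ forall S, S !=set0 ->
    below (fun a' => a' < a) S -> exists2 m, S m & lbound S m].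
  have [|a [Aa badS] la] := wA bad _ (ex_intro _ a0 (conj Aa0 nk)).
    by move=> ? [].
  apply: badS => S S0 bS.
  have [a1 [s [Aa1 a1a Ss b1]]] := step _ _ S0 bS.
  have [S'0|/set0P S'0] := eqVneq (S `&` [set s' | s' < s]) set0.
    exists s => // t St; rewrite leNgt; apply/negP => ts.
    by have : (S `&` [set s' | s' < s]) t by []; rewrite S'0.
  have [m [Sm /= ms] lm] : exists2 m, (S `&` [set s' | s' < s]) m &
      lbound (S `&` [set s' | s' < s]) m.
    apply: contrapT => nm.
    have : a <= a1 by apply: la; split=> // h; apply: nm; exact: h.
    by rewrite leNgt a1a.
  exists m => // t St; have [st|ts] := leP s t; last by apply: lm.
  by apply: le_trans st; exact: ltW.
move=> S SAB S0.
have bS : below (fun=> True) S.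
  by move=> s /SAB [a [b [Aa Bb sE]]]; exists a, b.
have [a [s [Aa _ Ss b1]]] := step _ _ S0 bS.
have [S'0|/set0P S'0] := eqVneq (S `&` [set s' | s' < s]) set0.
  exists s => // t St; rewrite leNgt; apply/negP => ts.
  by have : (S `&` [set s' | s' < s]) t by []; rewrite S'0.
have [m [Sm /= ms] lm] := key a Aa _ S'0 b1.
exists m => // t St; have [st|ts] := leP s t; last by apply: lm.
by apply: le_trans st; exact: ltW.
Qed.

Lemma finite_well_ordered_decomp A B c :
  well_ordered A -> well_ordered B -> finite_set [set a | A a /\ B (c - a)].
Proof.
move=> wA wB; set D := [set a | _]; apply: contrapT => infD.
have maxD S : S `<=` D -> S !=set0 -> exists2 m, S m & ubound S m.
  move=> SD [s Ss].
  have [||b /= Sb lb] := wB [set b | S (c - b)].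
  - by move=> b /= /SD [_]; rewrite subKr.
  - by exists (c - s); rewrite /= subKr.
  exists (c - b) => // t St.
  by rewrite lerBrDr addrC -lerBrDr; apply: lb; rewrite /= subKr.
have D0 : D !=set0.
  apply/set0P/eqP => D0; apply: infD; rewrite D0; exact: finite_set0.
have [M DM uM] := maxD D (@subset_refl _ D) D0.
pose E := [set d | D d /\ infinite_set (D `&` [set x | x <= d])].
have [||d [Dd infd] ld] := wA E.
- by move=> ? [[]].
- exists M; split=> //; rewrite (_ : _ `&` _ = D)//.
  by rewrite setIidPl => x /uM.
have infd' : infinite_set (D `&` [set x | x < d]).
  move=> fin; apply: infd.
  apply: (@sub_finite_set _ _ ((D `&` [set x | x < d]) `|` [set d])).
    move=> x [Dx /=]; rewrite le_eqVlt => /predU1P[->|xd]; first by right.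
    by left.
  by rewrite finite_setU; split=> //; exact: finite_set1.
have [||d1 [Dd1 /= d1d] ud1] := maxD (D `&` [set x | x < d]).
- exact: subIsetl.
- by apply/set0P/eqP => e0; apply: infd'; rewrite e0; exact: finite_set0.
have : d <= d1.
  apply: ld; split=> // fin; apply: infd'; apply: sub_finite_set fin => x [Dx xd].
  by split=> //; exact: ud1.
by rewrite leNgt d1d.
Qed.

End WellOrdered.
Arguments well_ordered_set1 {R} a [S] _ _.

HB.instance Definition _ (R : realType) := gen_eqMixin (hahn R).
HB.instance Definition _ (R : realType) := gen_choiceMixin (hahn R).

Section HahnRing.
Context {R : realType}.
Implicit Types (x y z : hahn R) (a b c : R).

Definition hsupp x : set R := [set a | x a != 0].

Lemma hsupp_wo x : well_ordered (hsupp x).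
Proof. by case: x. Qed.
Arguments hsupp_wo x [S] _ _.

Lemma hahnP x y : (forall a, x a = y a) -> x = y.
Proof.
case: x y => [x wx] [y wy] /= /funext xy; move: wx wy; rewrite xy => wx wy.
by rewrite (Prop_irrelevance wx wy).
Qed.

Fact hahn_monom_wo c a :
  well_ordered [set b : R | (if b == a then c else 0) != 0].
Proof.
apply: (well_ordered_sub _ (well_ordered_set1 a)) => b /=.
by case: (b =P a) => // _; rewrite eqxx.
Qed.
(** the monomial [c * t ^ a] *)
Definition hmonom c a := Hahn (@hahn_monom_wo c a).

Definition hzero : hahn R := hmonom 0 0.
Definition hone : hahn R := hmonom 1 0.

Fact hopp_wo x : well_ordered [set a | - x a != 0].
Proof.
by apply: (well_ordered_sub _ (hsupp_wo x)) => a; rewrite /hsupp /= oppr_eq0.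
Qed.
Definition hopp x : hahn R := Hahn (@hopp_wo x).

Fact hadd_wo x y : well_ordered [set a | x a + y a != 0].
Proof.
apply: (well_ordered_sub _ (well_orderedU (hsupp_wo x) (hsupp_wo y))) => a /=.
have [xa0|xa0 _] := eqVneq (x a) 0; last by left.
by rewrite xa0 add0r; right.
Qed.
Definition hadd x y : hahn R := Hahn (@hadd_wo x y).

Lemma hmul_fin x y c : exists2 s : seq R, uniq s &
  forall a, x a != 0 -> y (c - a) != 0 -> a \in s.
Proof.
have := finite_well_ordered_decomp c (hsupp_wo x) (hsupp_wo y).
move=> /finite_fsetP[X XE]; exists X => [|a xa ya]; first exact: fset_uniq.
by have : [set` X] a by rewrite -XE.
Qed.

(** Only finitely many terms are nonzero, by [hmul_fin]. *)
Definition hmul_coef x y c : R := \sum_(a \in [set: R]) x a * y (c - a).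

Lemma hmul_coefE (s : seq R) x y c : uniq s ->
    (forall a, x a != 0 -> y (c - a) != 0 -> a \in s) ->
  hmul_coef x y c = \sum_(a <- s) x a * y (c - a).
Proof.
move=> us sP; rewrite fsbig_seq// /hmul_coef.
apply/esym/fsbig_widen => // a [_ /= /negP nas].
apply/eqP; rewrite mulf_eq0; apply: contraT.
by rewrite negb_or => /andP[xa ya]; rewrite sP in nas.
Qed.

Lemma hmul_coef_neq0 x y c :
  hmul_coef x y c != 0 -> sumset (hsupp x) (hsupp y) c.
Proof.
apply: contraNP => nc; apply/eqP; rewrite /hmul_coef fsbig1// => a _.
apply/eqP; rewrite mulf_eq0; apply: contra_notT nc.
rewrite negb_or => /andP[xa ya]; exists a, (c - a); split=> //.
by rewrite addrC subrK.
Qed.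

Fact hmul_wo x y : well_ordered [set c | hmul_coef x y c != 0].
Proof.
apply: (well_ordered_sub _ (well_ordered_sumset (hsupp_wo x) (hsupp_wo y))).
by move=> c; exact: hmul_coef_neq0.
Qed.
Definition hmul x y : hahn R := Hahn (@hmul_wo x y).

Fact haddA : associative hadd.
Proof. by move=> x y z; apply: hahnP => a /=; rewrite addrA. Qed.
Fact haddC : commutative hadd.
Proof. by move=> x y; apply: hahnP => a /=; rewrite addrC. Qed.
Fact hadd0 : left_id hzero hadd.
Proof. by move=> x; apply: hahnP => a /=; case: ifP; rewrite add0r. Qed.
Fact haddN : left_inverse hzero hopp hadd.
Proof. by move=> x; apply: hahnP => a /=; case: ifP; rewrite addNr. Qed.

HB.instance Definition _ := GRing.isZmodule.Build (hahn R)
  haddA haddC hadd0 haddN.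

Fact hmulC : commutative hmul.
Proof.
move=> x y; apply: hahnP => c /=; have [s us sP] := hmul_fin x y c.
rewrite (hmul_coefE us sP) (@hmul_coefE [seq c - a | a <- s]).
- by rewrite big_map; apply: eq_bigr => a _; rewrite subKr mulrC.
- by rewrite map_inj_uniq// => a b /addrI /oppr_inj.
- move=> a ya xa; apply/mapP; exists (c - a); last by rewrite subKr.
  by apply: sP => //; rewrite subKr.
Qed.

Fact hmulDl : left_distributive hmul +%R.
Proof.
move=> x y z; apply: hahnP => c /=.
have [s us sP] := hmul_fin x z c; have [t ut tP] := hmul_fin y z c.
have uU : uniq (undup (s ++ t)) by exact: undup_uniq.
rewrite !(hmul_coefE uU) => [||a|a xa za].
- by rewrite -big_split /=; apply: eq_bigr => a _; rewrite mulrDl.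
- by move=> a ya za; rewrite mem_undup mem_cat tP ?orbT.
- by move=> xa za; rewrite mem_undup mem_cat sP.
- rewrite mem_undup mem_cat; have [xa0|xa0] := eqVneq (x a) 0.
    by rewrite (tP a) ?orbT//; move: xa; rewrite /= xa0 add0r.
  by rewrite sP.
Qed.

Fact hmulA : associative hmul.
Proof.
move=> x y z; apply: hahnP => c /=.
have wxy := well_ordered_sumset (hsupp_wo x) (hsupp_wo y).
have wyz := well_ordered_sumset (hsupp_wo y) (hsupp_wo z).
have /finite_fsetP[U UE] :=
  finite_well_ordered_decomp c wxy (hsupp_wo z).
have /finite_fsetP[A AE] :=
  finite_well_ordered_decomp c (hsupp_wo x) wyz.
have inU s : sumset (hsupp x) (hsupp y) s -> z (c - s) != 0 -> s \in U.
  by move=> xys zs; have : [set` U] s by rewrite -UE.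
have inA a : x a != 0 -> sumset (hsupp y) (hsupp z) (c - a) -> a \in A.
  by move=> xa yza; have : [set` A] a by rewrite -AE.
rewrite (@hmul_coefE A) ?fset_uniq// => [|a xa yza]; last first.
  by apply: inA => //; exact: hmul_coef_neq0.
rewrite (@hmul_coefE U) ?fset_uniq// => [|s xys zs]; last first.
  by apply: inU => //; exact: hmul_coef_neq0.
transitivity (\sum_(a <- A) \sum_(s <- U) x a * y (s - a) * z (c - s)).
  apply: eq_bigr => a _; rewrite [hcoef (hmul y z) _]/=.
  have [xa0|xa] := eqVneq (x a) 0.
    by rewrite xa0 mul0r big1// => s _; rewrite !mul0r.
  rewrite (@hmul_coefE [seq s - a | s <- U]).
  - rewrite big_map mulr_sumr; apply: eq_bigr => s _.
    by rewrite opprB addrA subrK mulrA.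
  - by rewrite map_inj_uniq ?fset_uniq// => s t /addIr.
  - move=> b yb zb; apply/mapP; exists (b + a); last by rewrite addrK.
    apply: inU; last by rewrite (addrC b) opprD addrA.
    by exists a, b; split=> //; rewrite addrC.
rewrite exchange_big /=; apply: eq_bigr => s _.
have [zs0|zs] := eqVneq (z (c - s)) 0.
  by rewrite zs0 mulr0 big1// => a _; rewrite mulr0.
rewrite (@hmul_coefE A) ?fset_uniq// ?mulr_suml// => a xa ya.
by apply: inA => //; exists (s - a), (c - s); split=> //; rewrite [RHS]addrC addrA subrK.
Qed.

Lemma hmul_monomE c b x a : hmul (hmonom c b) x a = c * x (a - b).
Proof.
rewrite /= (@hmul_coefE [:: b])//; first by rewrite big_seq1 /= eqxx.
by move=> d /=; rewrite mem_seq1; case: ifP => //; rewrite eqxx.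
Qed.

Fact hmul1 : left_id hone hmul.
Proof. by move=> x; apply: hahnP => a; rewrite hmul_monomE mul1r subr0. Qed.

Fact hone_neq0 : hone != 0.
Proof.
apply/eqP => /(congr1 (fun x : hahn R => x 0)) /=.
by rewrite !eqxx => /eqP; rewrite oner_eq0.
Qed.

HB.instance Definition _ := GRing.Zmodule_isComNzRing.Build (hahn R)
  hmulA hmulC hmul1 hmulDl hone_neq0.

Lemma hahn0E a : (0 : hahn R) a = 0.
Proof. by rewrite /=; case: ifP. Qed.
Lemma hahn1E a : (1 : hahn R) a = (a == 0)%:R.
Proof. by rewrite /=; case: ifP. Qed.
Lemma hahnDE x y a : (x + y) a = x a + y a.
Proof. by []. Qed.
Lemma hahnNE x a : (- x) a = - x a.
Proof. by []. Qed.
Lemma hahnME x y c : (x * y) c = \sum_(a \in [set: R]) x a * y (c - a).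
Proof. by []. Qed.

(** [minexp x] is the least element of the support of [x] (junk value [0] when
    [x = 0]). *)
Definition minexp x : R := xget 0 [set a | hsupp x a /\ lbound (hsupp x) a].

Lemma minexpP x : x != 0 ->
  x (minexp x) != 0 /\ forall a, a < minexp x -> x a = 0.
Proof.
move=> x0; rewrite /minexp; case: xgetP => [m _ [xm lm]|nm].
  split=> // a am; apply/eqP; apply: contraT => xa.
  by have := lm _ xa; rewrite leNgt am.
exfalso; have [|m xm lm] := hsupp_wo x (@subset_refl _ (hsupp x)).
- apply: contrapT => /set0P/negP; rewrite negbK => /eqP sx.
  move/negP: x0; apply; apply/eqP/hahnP => a; rewrite hahn0E.
  apply/eqP; apply: contraT => xa.
  by have : hsupp x a by []; rewrite sx.
- by apply: (nm m).
Qed.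

Lemma minexp_eq x m :
  x m != 0 -> (forall a, a < m -> x a = 0) -> minexp x = m.
Proof.
move=> xm lm; have x0 : x != 0.
  by apply: contraNneq xm => ->; rewrite hahn0E.
have [xn ln] := minexpP x0; have [||//] := ltgtP (minexp x) m.
- by move=> /lm /eqP; rewrite (negPf xn).
- by move=> /ln /eqP; rewrite (negPf xm).
Qed.

Lemma hahnM_lt x y m n c : (forall a, a < m -> x a = 0) ->
  (forall b, b < n -> y b = 0) -> c < m + n -> (x * y) c = 0.
Proof.
move=> xm yn cmn; rewrite hahnME fsbig1// => a _.
have [am|ma] := ltP a m; first by rewrite xm// mul0r.
rewrite yn ?mulr0// ltrBlDr; apply: lt_le_trans cmn _.
by rewrite addrC lerD2l.
Qed.

Lemma hahnM_lead x y m n : (forall a, a < m -> x a = 0) ->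
  (forall b, b < n -> y b = 0) -> (x * y) (m + n) = x m * y n.
Proof.
move=> xm yn; rewrite [LHS](@hmul_coefE [:: m])//.
  by rewrite big_seq1 addrC addKr.
move=> a xa ya; rewrite mem_seq1 eq_le; apply/andP; split.
- rewrite leNgt; apply: contra ya => ma; apply/eqP/yn.
  by rewrite ltrBlDl ltrD2r.
- by rewrite leNgt; apply: contra xa => am; apply/eqP/xm.
Qed.

Definition hpos x : bool := 0 < x (minexp x).

Lemma hposP x m : (forall a, a < m -> x a = 0) -> 0 < x m -> hpos x.
Proof.
by move=> lm xm; rewrite /hpos (minexp_eq (m := m))// gt_eqF.
Qed.

Lemma hpos_neq0 x : hpos x -> x != 0.
Proof. by apply: contraTneq => ->; rewrite /hpos hahn0E ltxx. Qed.

Lemma hposM x y : hpos x -> hpos y -> hpos (x * y).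
Proof.
move=> px py; have [_ lx] := minexpP (hpos_neq0 px).
have [_ ly] := minexpP (hpos_neq0 py).
apply: (@hposP _ (minexp x + minexp y)).
  by move=> a; exact: hahnM_lt.
by rewrite hahnM_lead// mulr_gt0.
Qed.

Lemma hposD x y : hpos x -> hpos y -> hpos (x + y).
Proof.
wlog xy : x y / minexp x <= minexp y => [hw px py|].
  have [|/ltW] := leP (minexp x) (minexp y) => h; first exact: hw.
  by rewrite addrC; exact: hw.
move=> px py; have [_ lx] := minexpP (hpos_neq0 px).
have [_ ly] := minexpP (hpos_neq0 py).
apply: (@hposP _ (minexp x)) => [a am|]; rewrite hahnDE.
  by rewrite lx// ly ?addr0//; exact: lt_le_trans xy.
move: xy; rewrite le_eqVlt => /predU1P[xy|xy].
  by rewrite addr_gt0// xy.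
by rewrite ly// addr0.
Qed.

Lemma hposN x : x != 0 -> hpos (- x) = ~~ hpos x.
Proof.
move=> x0; have [xm lm] := minexpP x0.
rewrite /hpos (@minexp_eq (- x) (minexp x)) ?hahnNE ?oppr_eq0//.
  by rewrite oppr_gt0 -leNgt le_eqVlt (negPf xm).
by move=> a am; rewrite hahnNE lm ?oppr0.
Qed.

Lemma hahn_inv_ex x : x != 0 -> exists y, y * x = 1.
Proof.
move=> x0; have [xm lm] := minexpP x0; set m := minexp x in xm lm.
pose P y := forall a, y a != 0 -> forall b, b <= a -> (1 - y * x) (b + m) = 0.
pose T := {y | P y}.
pose le (y y' : T) := `[< forall a, sval y a != 0 ->
  forall b, b <= a -> sval y' b = sval y b >].
have agree y y' a : (forall b, b <= a -> y' b = y b) ->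
    (1 - y' * x) (a + m) = (1 - y * x) (a + m).
  move=> yy'; rewrite !hahnDE !hahnNE !hahnME; congr (_ - _).
  apply: eq_fsbigr => b _; have [ba|ab] := leP b a; first by rewrite yy'.
  by rewrite lm ?mulr0// ltrBlDr addrC ltrD2l.
have [||||[y Py] ymax] := @Zorn T le.
- by move=> y; apply/asboolP.
- move=> r s t /asboolP rs /asboolP st; apply/asboolP => a ra b ba.
  by rewrite (st a) ?(rs a).
- move=> [s Ps] [t Pt] /asboolP /= st /asboolP /= ts.
  apply: eq_exist; apply: hahnP => a.
  have [sa|sa] := eqVneq (s a) 0; last by rewrite (st a).
  by have [->//|ta] := eqVneq (t a) 0; rewrite (ts a).
- move=> A tA.
  pose f a : R := xget 0 [set r | r != 0 /\ exists2 y, A y & sval y a = r].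
  have fE (y : T) a b : A y -> sval y a != 0 -> b <= a -> f b = sval y b.
    move=> Ay ya ba; rewrite /f; case: xgetP => [r _ [r0 [y' Ay' y'b]]|nr].
      have [/asboolP h|/asboolP h] := tA _ _ Ay Ay'.
        by rewrite -y'b (h a).
      by rewrite (h b) ?y'b.
    apply/esym/eqP; apply: contraT => yb.
    by exfalso; apply: (nr (sval y b)); split=> //; exists y.
  have fA a : f a != 0 -> exists2 y, A y & sval y a != 0.
    rewrite /f; case: xgetP => [r _ [r0 [y Ay ya]] _|_]; last by rewrite eqxx.
    by exists y => //; rewrite ya.
  have wf : well_ordered [set a | f a != 0].
    move=> S Sf [s Ss]; have [y Ay ys] := fA _ (Sf _ Ss).
    have [|| n [Sn /= ns] ln] := hsupp_wo (sval y) (S := S `&` [set b | b <= s]).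
    - by move=> b [/Sf /= fb bs]; rewrite /hsupp /= -(fE y s).
    - by exists s; split=> //=.
    exists n => // t St; have [ts|st] := leP t s; first exact: ln.
    by apply: le_trans ns _; exact: ltW.
  have Pf : P (Hahn wf).
    move=> a fa b ba; have [y Ay ya] := fA _ fa.
    rewrite (@agree (sval y)); first exact: (proj2_sig y a ya b ba).
    by move=> c cb /=; apply: (fE y a) => //; exact: le_trans ba.
  exists (exist _ _ Pf) => y Ay; apply/asboolP => a ya b ba /=.
  exact: fE ya ba.
exists y; apply/esym/eqP; rewrite -subr_eq0; apply: contraT => e0.
have [] := minexpP e0; set g := minexp _; set e := (1 - y * x) => eg lg.
have yg a : y a != 0 -> a < g - m.
  move=> ya; rewrite ltNge; apply/negP => ga.
  by have := Py a ya (g - m) ga; rewrite subrK; apply/eqP.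
pose q := hmonom (e g / x m) (g - m).
have qE a : q a = if a == g - m then e g / x m else 0 by [].
have Py' : P (y + q).
  move=> a ya b ba.
  have ag : a <= g - m.
    rewrite leNgt; apply: contra ya => ga; rewrite hahnDE qE (gt_eqF ga) addr0.
    by apply: contraT => /yg; rewrite ltNge (ltW ga).
  rewrite mulrDl opprD addrA hahnDE hahnNE (hmul_monomE _ _ x) -/e.
  have := le_trans ba ag; rewrite le_eqVlt => /predU1P[->|bg].
    by rewrite subrK subKr divfK// subrr.
  have bmg : b + m < g by rewrite -ltrBrDr.
  rewrite (lg _ bmg) sub0r (lm (b + m - (g - m))) ?mulr0 ?oppr0//.
  by rewrite ltrBlDr [ltRHS]addrC ltrD2r.
have : le (exist _ _ Py) (exist _ _ Py').
  apply/asboolP => a /= ya b ba.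
  by rewrite lt_eqF ?addr0//; apply: le_lt_trans ba _; exact: yg.
move=> /ymax [] /(congr1 (fun z : hahn R => z (g - m))) /=.
rewrite eqxx => /eqP; rewrite -subr_eq0 addrC addKr mulf_eq0 invr_eq0.
by rewrite (negPf xm) (negPf eg).
Qed.

Definition hinv x : hahn R := xget 0 [set y | x != 0 /\ y * x = 1].

Fact hmulV x : x != 0 -> hinv x * x = 1.
Proof.
move=> x0; rewrite /hinv; case: xgetP => [y _ []//|nx].
have [y yx] := hahn_inv_ex x0.
by exfalso; apply: (nx y).
Qed.

Fact hinv0 : hinv 0 = 0.
Proof. by rewrite /hinv; case: xgetP => // y _ []; rewrite eqxx. Qed.

HB.instance Definition _ := GRing.ComNzRing_isField.Build (hahn R) hmulV hinv0.

Definition hlt x y : bool := hpos (y - x).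
Definition hle x y : bool := (x == y) || hlt x y.
Definition hnorm x : hahn R := if hpos x then x else - x.

Fact hlt0_add x y : hlt 0 x -> hlt 0 y -> hlt 0 (x + y).
Proof. by rewrite /hlt !subr0; exact: hposD. Qed.
Fact hlt0_mul x y : hlt 0 x -> hlt 0 y -> hlt 0 (x * y).
Proof. by rewrite /hlt !subr0; exact: hposM. Qed.
Fact hlt0_ngt0 x : hlt 0 x -> ~~ hlt x 0.
Proof.
rewrite /hlt subr0 sub0r => px; have x0 := hpos_neq0 px.
by rewrite hposN// px.
Qed.
Fact hsub_gt0 x y : hlt 0 (y - x) = hlt x y.
Proof. by rewrite /hlt subr0. Qed.
Fact hlt0_total x : x != 0 -> hlt 0 x || hlt x 0.
Proof. by move=> x0; rewrite /hlt subr0 sub0r hposN// orbN. Qed.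
Fact hnormN x : hnorm (- x) = hnorm x.
Proof.
rewrite /hnorm; have [->|x0] := eqVneq x 0; first by rewrite !oppr0.
by rewrite hposN//; case: (hpos x) => /=; rewrite ?opprK.
Qed.
Fact hge0_norm x : hle 0 x -> hnorm x = x.
Proof.
rewrite /hle /hlt subr0 /hnorm => /orP[/eqP <-|->//].
by case: ifP; rewrite ?oppr0.
Qed.

HB.instance Definition _ := Num.IntegralDomain_isLtReal.Build (hahn R)
  hlt0_add hlt0_mul hlt0_ngt0 hsub_gt0 hlt0_total hnormN hge0_norm
  (fun x y => erefl (hle x y)).

Definition hval x : \bar R := if x == 0 then -oo%E else (- minexp x)%:E.

End HahnRing.
Arguments hsupp_wo {R} x [S] _ _.

(** * Tropical projective space *)

Section TropicalProjectiveSpace.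
Context {R : realType} {n : nat}.

Definition trop_eq (x y : 'rV[R]_n) : bool :=
  `[< exists c : R, y = x + const_mx c >].

Fact trop_eq_refl : reflexive trop_eq.
Proof.
by move=> x; apply/asboolP; exists 0; apply/rowP => i; rewrite !mxE addr0.
Qed.

Fact trop_eq_sym : symmetric trop_eq.
Proof.
suff h x y : trop_eq x y -> trop_eq y x by move=> x y; apply/idP/idP; exact: h.
move=> /asboolP[c ->]; apply/asboolP; exists (- c).
by apply/rowP => i; rewrite !mxE addrK.
Qed.

Fact trop_eq_trans : transitive trop_eq.
Proof.
move=> y x z /asboolP[c ->] /asboolP[d ->]; apply/asboolP; exists (c + d).
by apply/rowP => i; rewrite !mxE addrA.
Qed.

Canonical trop_eq_equiv :=
  EquivRel trop_eq trop_eq_refl trop_eq_sym trop_eq_trans.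

End TropicalProjectiveSpace.

(** [TP R n] is the quotient of [R^n] by the line spanned by [(1,...,1)], that
    is, the tropical projective space of dimension [n - 1]. *)
Definition TP (R : realType) (n : nat) : Type :=
  quotient_topology {eq_quot (@trop_eq R n)}%qT.

HB.instance Definition _ (R : realType) (n : nat) := Quotient.on (TP R n).
HB.instance Definition _ (R : realType) (n : nat) := Topological.on (TP R n).

Definition toTP (R : realType) (n : nat) (x : 'rV[R]_n) : TP R n :=
  (\pi_(TP R n) x)%qT.

(** Coordinates of the chosen representative of [a]; only their differences are
    determined by [a]. *)
Definition tcoord (R : realType) (n : nat) (a : TP R n) (i : 'I_n) : R :=
  (repr a : 'rV[R]_n) 0 i.

(** * Tropical polytopes, half-spaces and pseudovertices *)

Section TropicalConvexity.
Context {R : realType} {n : nat}.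
Implicit Types (a : TP R n) (I : {set 'I_n}) (P : set (TP R n)).

(** The choice of representatives in [tcoord] is immaterial here and below: in
    [trop_polytope] another representative of [v r] shifts [lambda r], and in
    the other definitions it adds the same constant to all terms compared. *)
Definition trop_polytope {p : nat} (v : 'I_p -> TP R n) : set (TP R n) :=
  [set toTP x | x in [set x : 'rV[R]_n | exists lambda : 'I_p -> R,
    forall i, (x 0 i)%:E =
      \big[maxe/-oo%E]_(r < p) (lambda r + tcoord (v r) i)%:E]].

Definition pure P : Prop := P = closure (interior P).

Definition trop_halfspace a I : set (TP R n) :=
  [set x : TP R n |
           (\big[maxe/-oo]_(j in ~: I) (tcoord x j - tcoord a j)%:E <=
            \big[maxe/-oo]_(i in I) (tcoord x i - tcoord a i)%:E)%E].

Definition nonempty_proper I : Prop := I != finset.set0 /\ I != [set: 'I_n]%SET.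

Definition is_trop_halfspace (H : set (TP R n)) : Prop :=
  exists a I, nonempty_proper I /\ H = trop_halfspace a I.

Definition external_representation (F : set (set (TP R n))) P : Prop :=
  [/\ finite_set F, F `<=` is_trop_halfspace & \bigcap_(H in F) H = P].

Section Generators.
Context {p : nat} (v : 'I_p -> TP R n).

Definition trop_type a (i : 'I_n) : {set 'I_p} :=
  [set r : 'I_p | [forall k : 'I_n, tcoord (v r) k - tcoord a k <=
                             tcoord (v r) i - tcoord a i]]%SET.

Definition pseudovertex I (j : 'I_n) a : Prop :=
  [/\ (\bigcup_(i in I) trop_type a i = [set: 'I_p])%SET,
      (forall k, k \notin I ->
         exists2 i, i \in I & trop_type a i :&: trop_type a k != finset.set0) &
      (forall i, i \in I -> ~~ (trop_type a i :&: trop_type a j \subset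
                               \bigcup_(h in I :\ i) trop_type a h))]%SET.

Definition trop_weight {m : nat} (U : 'M[R]_m) (s : 'S_m) : R :=
  \sum_i U i (s i).

Definition trop_singular {m : nat} (U : 'M[R]_m) : Prop :=
  exists s t : 'S_m, [/\ s != t,
    forall u : 'S_m, trop_weight U u <= trop_weight U s &
    forall u : 'S_m, trop_weight U u <= trop_weight U t].

(** Changing the representative of a point adds a constant to a column, hence to
    the weight of every permutation, of each submatrix using that column. *)
Definition general_position : Prop :=
  forall (m : nat) (f : 'I_m -> 'I_n) (g : 'I_m -> 'I_p),
    {homo f : i k / (i < k)%N} -> {homo g : i k / (i < k)%N} ->
    ~ trop_singular (mxsub f g (\matrix_(i, r) tcoord (v r) i)).

End Generators.
End TropicalConvexity.

(** * Polyhedral cones over an ordered field *)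

Section Cones.
Context {K : realFieldType} {n : nat}.
Implicit Types (f x : 'rV[K]_n) (C F H : set 'rV[K]_n).

Definition cone {p : nat} (V : 'I_p -> 'rV[K]_n) : set 'rV[K]_n :=
  [set x | exists2 c : 'I_p -> K, forall r, 0 <= c r & x = \sum_r c r *: V r].

Definition halfspace f : set 'rV[K]_n := [set x | 0 <= \sum_i f 0 i * x 0 i].
Definition hyperplane f : set 'rV[K]_n := [set x | \sum_i f 0 i * x 0 i = 0].

Definition is_face C F : Prop :=
  exists2 f, C `<=` halfspace f & F = C `&` hyperplane f.

(** Dimension of the linear span, which for sets containing [0], such as the
    faces of a cone, is also the affine hull. *)
Definition has_dim (F : set 'rV[K]_n) (d : nat) : Prop :=
  exists U : {vspace 'rV[K]_n}, [/\ forall x, F x -> x \in U,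
    forall W : {vspace 'rV[K]_n}, (forall x, F x -> x \in W) -> (U <= W)%VS &
    \dim U = d].

Definition is_facet C F : Prop := is_face C F /\ has_dim F n.-1.

Definition facet_defining C H : Prop :=
  exists f, [/\ f != 0, H = halfspace f, C `<=` H &
                is_facet C (C `&` hyperplane f)].

End Cones.

(** * Lifts and images under the valuation *)

Section Lifts.
Context {R : realType} {n : nat}.

Definition positive_vec (x : 'rV[hahn R]_n) : Prop := forall i, 0 < x 0 i.

(** Meaningful for vectors with nonzero entries, where [hval] is finite. *)
Definition vec_val (x : 'rV[hahn R]_n) : TP R n :=
  toTP (\row_i fine (hval (x 0 i))).

Definition is_lift {p : nat} (v : 'I_p -> TP R n) (C : set 'rV[hahn R]_n) :
    Prop :=
  exists V : 'I_p -> 'rV[hahn R]_n,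
    [/\ forall r, positive_vec (V r), forall r, vec_val (V r) = v r &
        C = cone V].

Definition val_image (H : set 'rV[hahn R]_n) : set (TP R n) :=
  [set vec_val x | x in H `&` positive_vec].

Definition facet_images (C : set 'rV[hahn R]_n) : set (set (TP R n)) :=
  [set val_image H | H in facet_defining C].

End Lifts.

(* Main.v *)
(** Let [N(r)] be the set of the [l] with [r \in S_l(a)]. At an
    (I,j)-pseudovertex [a], general position makes the bipartite graph of the
    pairs [(r, l)] with [l \in N(r)] a forest, and purity, applied at [a] and at
    points near [a], forces every generator with [N(r)] not included in [I] to
    have degree two. These generators are the edges of a tree on the coordinates,
    each joining [I] to its complement. The hyperplane through their lifts then
    has a normal vector whose leading terms, propagated along the tree, have
    exponents [a] and are positive exactly on [I]; it defines a facet whose image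
    is [H(a, I)].

    A point [x] outside the polytope has an empty [S_j(x)], which gives a
    half-space excluding [x] by its [j]-th inequality. Taking [I] minimal among
    those and tightening the apex one coordinate at a time produces an
    (I,j)-pseudovertex, so the facet images cut out exactly the polytope. *)
Require Import Defs.
From mathcomp Require Import all_boot all_order all_algebra perm generic_quotient.
From mathcomp Require Import all_classical all_reals all_analysis.
From mathcomp Require Import ring lra.

Set Implicit Arguments.
Unset Strict Implicit.
Unset Printing Implicit Defensive.

Import Order.TTheory GRing.Theory Num.Theory.
Import numFieldNormedType.Exports.

Local Open Scope classical_set_scope.
Local Open Scope ring_scope.

(** * Leading terms of Hahn series *)

Section LeadingTerms.
Context {R : realType}.
Implicit Types (x y : hahn R) (e c d : R).

(** [c] is the coefficient of [t ^ e], possibly zero, in a series all of whose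
    terms have exponent at least [e]. *)
Definition lead x e c := (forall a, a < e -> x a = 0) /\ x e = c.

Lemma lead_minexp x : lead x (minexp x) (x (minexp x)).
Proof.
split=> // a am; have [->|/minexpP[_]] := eqVneq x 0; last exact.
exact: hahn0E.
Qed.

Lemma lead0 e : lead 0 e 0.
Proof. by split=> [a _|]; exact: hahn0E. Qed.

Lemma leadN x e c : lead x e c -> lead (- x) e (- c).
Proof.
move=> [xe <-]; split=> [a ae|]; last exact: hahnNE.
by rewrite hahnNE xe ?oppr0.
Qed.

Lemma leadD x y e c d : lead x e c -> lead y e d -> lead (x + y) e (c + d).
Proof.
move=> [xe <-] [ye <-]; split=> [a ae|]; last exact: hahnDE.
by rewrite hahnDE xe ?ye ?addr0.
Qed.

Lemma leadM x y e e' c d :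
  lead x e c -> lead y e' d -> lead (x * y) (e + e') (c * d).
Proof.
move=> [xe <-] [ye <-]; split=> [a ae|]; last exact: hahnM_lead.
exact: (hahnM_lt xe ye).
Qed.

Lemma lead_weak x e e' c : lead x e c -> e' < e -> lead x e' 0.
Proof. by move=> [xe _] ee'; split=> [a ae|]; apply: xe => //; apply: lt_trans ee'. Qed.

Lemma lead_sum (T : Type) (s : seq T) (P : pred T) (F : T -> hahn R) e
    (c : T -> R) :
  (forall i, P i -> lead (F i) e (c i)) ->
  lead (\sum_(i <- s | P i) F i) e (\sum_(i <- s | P i) c i).
Proof.
move=> Fc; elim/big_rec2: _ => [|i y d Pi]; first exact: lead0.
by apply: leadD; exact: Fc.
Qed.

Lemma lead_monom c e : lead (hmonom c e) e c.
Proof.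
by split=> [a ae|] /=; rewrite ?eqxx ?lt_eqF.
Qed.

Lemma lead_prod (T : Type) (s : seq T) (P : pred T) (F : T -> hahn R)
    (e c : T -> R) :
  (forall i, P i -> lead (F i) (e i) (c i)) ->
  lead (\prod_(i <- s | P i) F i) (\sum_(i <- s | P i) e i)
    (\prod_(i <- s | P i) c i).
Proof.
move=> Fc; elim: s => [|i s IH]; first by rewrite !big_nil; exact: lead_monom.
by rewrite !big_cons; case: ifP => // Pi; apply: leadM => //; exact: Fc.
Qed.

Lemma lead_uniq x e c d : lead x e c -> lead x e d -> c = d.
Proof. by move=> [_ <-] [_ <-]. Qed.

Lemma minexp_lead x e c : lead x e c -> c != 0 -> minexp x = e.
Proof. by move=> [xe <-] c0; exact: minexp_eq. Qed.

Lemma lead_neq0 x e c : lead x e c -> c != 0 -> x != 0.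
Proof. by move=> [_ <-]; apply: contraNneq => ->; rewrite hahn0E. Qed.

Lemma hahn_gt0 x : (0 < x) = (0 < x (minexp x)).
Proof. by rewrite -[LHS]/(hpos (x - 0)) subr0. Qed.

Lemma lead_gt0 x e c : lead x e c -> 0 < c -> 0 < x.
Proof.
move=> xe c0; rewrite hahn_gt0 (minexp_lead xe) ?gt_eqF//.
by case: xe => _ ->.
Qed.

Lemma lead_lt0 x e c : lead x e c -> c < 0 -> x < 0.
Proof.
move=> /leadN xe c0; rewrite -oppr_gt0; apply: lead_gt0 xe _.
by rewrite oppr_gt0.
Qed.

Lemma hahn_lead_eq0 x : (x (minexp x) == 0) = (x == 0).
Proof.
have [->|/minexpP[/negPf]//] := eqVneq x 0.
by rewrite hahn0E eqxx.
Qed.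

Lemma hahn_lt0 x : (x < 0) = (x (minexp x) < 0).
Proof.
by rewrite !lt_neqAle hahn_lead_eq0 !leNgt hahn_gt0.
Qed.

Lemma lead_ge0 x e c : lead x e c -> 0 <= x -> 0 <= c.
Proof. by move=> /lead_lt0 h; rewrite !leNgt; exact: contra. Qed.

End LeadingTerms.

(** * Half-spaces, polytopes and types in tropical projective space *)

Section TropicalBasics.
Context {R : realType} {n : nat}.
Implicit Types (a b : TP R n) (I : {set 'I_n}).

Lemma toTP_shift (x y : 'rV[R]_n) c :
  (forall i, y 0 i = x 0 i + c) -> toTP x = toTP y.
Proof.
move=> xy; apply/eqmodP/asboolP; exists c.
by apply/rowP => i; rewrite !mxE xy.
Qed.

Lemma tcoord_toTP (x : 'rV[R]_n) : exists c, forall i, tcoord (toTP x) i = x 0 i + c.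
Proof.
have /eqmodP/asboolP[c xc] : (\pi_(TP R n) x = \pi_(TP R n) (repr (toTP x)))%qT.
  by rewrite reprK.
by exists c => i; rewrite /tcoord xc !mxE.
Qed.

Lemma toTP_tcoord a : toTP (\row_i tcoord a i) = a.
Proof.
rewrite -[RHS]reprK; apply: (@toTP_shift _ _ 0) => i.
by rewrite !mxE addr0.
Qed.

Lemma ex_argmax (F : 'I_n -> R) (i0 : 'I_n) : exists i, forall k, F k <= F i.
Proof.
by case: (@arg_maxP _ _ _ i0 xpredT F) => // i _ h; exists i => k; exact: h.
Qed.

Lemma trop_halfspaceP a I b : trop_halfspace a I b <->
  forall j, j \notin I -> exists2 i, i \in I &
    tcoord b j - tcoord a j <= tcoord b i - tcoord a i.
Proof.
rewrite /trop_halfspace /=; set F := fun i => tcoord b i - tcoord a i; split.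
- move=> /bigmax_leP[_ h] j jI; apply: contrapT => nj.
  have /h : j \in ~: I by rewrite inE.
  apply/negP; rewrite -ltNge; apply/bigmax_ltP; split; first exact: ltNyr.
  move=> i iI; rewrite lte_fin ltNge; apply/negP => ji.
  by apply: nj; exists i.
- move=> h; apply/bigmax_leP; split; first exact: leNye.
  move=> j; rewrite inE => /h[i iI ji].
  by apply: (@le_trans _ _ (F i)%:E); [rewrite lee_fin|exact: le_bigmax_cond].
Qed.

(** The class of [a + e w] varies continuously with [e], so an open set leaves room for a positive
    step along any direction. *)
Lemma open_TP_line (W : set (TP R n)) a (w : 'rV[R]_n) : open W -> W a ->
  exists2 e : R, 0 < e & W (toTP (\row_i tcoord a i + e *: w)).
Proof.
move=> oW Wa; pose g (e : R) : 'rV[R]_n := \row_i tcoord a i + e *: w.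
have cg : g e @[e --> 0] --> g 0.
  by apply: cvgD; [exact: cvg_cst | apply: cvgZr_tmp; exact: cvg_id].
have : \forall e \near (0 : R), W (toTP (g e)).
  apply: (cg (fun y => W (toTP y))); apply: open_nbhs_nbhs; split; first exact: oW.
  by rewrite /preimage /= /g scale0r addr0 (_ : toTP _ = a)//; exact: toTP_tcoord.
move=> /nbhs_ballP[e /= e0 he]; exists (e / 2); first by rewrite divr_gt0.
by apply: he; rewrite /ball /= sub0r normrN ger0_norm; lra.
Qed.

Section Generators.
Context {p : nat} (v : 'I_p -> TP R n).

Lemma mem_trop_type a i r : reflect
  (forall k, tcoord (v r) k - tcoord a k <= tcoord (v r) i - tcoord a i)
  (r \in trop_type v a i).
Proof. by rewrite inE; exact: forallP. Qed.

Lemma ex_trop_level a : exists M : 'I_p -> R, forall r i,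
  tcoord (v r) i - tcoord a i <= M r /\
  (r \in trop_type v a i) = (tcoord (v r) i - tcoord a i == M r).
Proof.
suff /boolp.choice[M MP] : forall r, exists m, forall i,
    tcoord (v r) i - tcoord a i <= m /\
    (r \in trop_type v a i) = (tcoord (v r) i - tcoord a i == m) by exists M.
move=> r; have [[i0 _]|n0] := pselect (exists i : 'I_n, True); last first.
  by exists 0 => i; exfalso; apply: n0; exists i.
have [k km] := ex_argmax (fun i => tcoord (v r) i - tcoord a i) i0.
exists (tcoord (v r) k - tcoord a k) => i; split; first exact: km.
apply/mem_trop_type/eqP => [ri|-> //]; apply/eqP.
by rewrite eq_le km ri.
Qed.

(** A generator that stays below [a] and touches it in coordinate [i] has its index in [S_i(a)].
    Conversely [- M r] is the largest admissible multiplier, and it makes the generators of [S_i(a)]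
    touch at [i]. *)
Lemma trop_polytopeP a : trop_polytope v a <->
  forall i, exists r, r \in trop_type v a i.
Proof.
split=> [[x [l xl] <-] i|h].
- have [c xc] := tcoord_toTP x.
  have lx k r : l r + tcoord (v r) k <= x 0 k.
    by rewrite -lee_fin xl; exact: le_bigmax.
  suff [r xr] : exists r, x 0 i <= l r + tcoord (v r) i.
    exists r; apply/mem_trop_type => k; rewrite !xc.
    have := lx k r; lra.
  apply: contrapT => nr.
  have : ((x 0 i)%:E < (x 0 i)%:E)%E.
    rewrite {1}xl; apply/bigmax_ltP; split; first exact: ltNyr.
    move=> r _; rewrite lte_fin ltNge; apply/negP => xr.
    by apply: nr; exists r.
  by rewrite ltxx.
- exists (\row_i tcoord a i); last exact: toTP_tcoord.
  have [l lP] := ex_trop_level a.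
  exists (fun r => - l r) => i; rewrite mxE; apply/eqP; rewrite eq_le.
  apply/andP; split.
    have [r ri] := h i.
    apply: (@le_trans _ _ (- l r + tcoord (v r) i)%:E);
      last exact: (@le_bigmax _ _ _ _ (fun r => (- l r + tcoord (v r) i)%:E)).
    by have [_] := lP r i; rewrite ri => /esym/eqP; rewrite lee_fin; lra.
  apply/bigmax_leP; split=> [|r _]; first exact: leNye.
  by have [+ _] := lP r i; rewrite lee_fin; lra.
Qed.

(** The inequalities defining [trop_type] that fail at [a] fail nearby. *)
Lemma trop_type_usc a : exists2 U : set (TP R n), open U /\ U a &
  forall b, U b -> forall i, trop_type v b i \subset trop_type v a i.
Proof.
pose Q (u : 'I_p * 'I_n * 'I_n) (x : 'I_n -> R) :=
  tcoord (v u.1.1) u.1.2 - tcoord a u.1.2 < tcoord (v u.1.1) u.2 - tcoord a u.2 ->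
  tcoord (v u.1.1) u.1.2 - x u.1.2 < tcoord (v u.1.1) u.2 - x u.2.
exists [set b | forall u, Q u (tcoord b)]; last first.
  move=> b h i; apply/fintype.subsetP => r /mem_trop_type ri; apply/mem_trop_type => k.
  by have := ri k; rewrite !leNgt; apply: contra => /(h (r, i, k)).
split; last by move=> u; rewrite /Q.
rewrite /open /= /quotient_open.
rewrite (_ : _ @^-1` _ = [set x : 'rV[R]_n | forall u, Q u (x 0)]); last first.
  rewrite predeqE => x /=; have [c xc] := tcoord_toTP x.
  split=> h u Qu; have := h u Qu; rewrite !xc; lra.
rewrite openE => x Qx; rewrite /interior /=.
apply: (@filter_forall 'rV[R]_n _ (fun u (y : 'rV[R]_n) => Q u (y 0)) (nbhs x)) => u.
have [au|au] := ltP (tcoord (v u.1.1) u.1.2 - tcoord a u.1.2)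
  (tcoord (v u.1.1) u.2 - tcoord a u.2); last first.
  by apply: nearW => y; rewrite /Q ltNge au.
have cx : (fun y : 'rV[R]_n => y 0 u.1.2 - y 0 u.2) y @[y --> x] --> x 0 u.1.2 - x 0 u.2.
  apply: (@cvgB _ _ _ (nbhs x) _ (fun y : 'rV[R]_n => y 0 u.1.2)
    (fun y : 'rV[R]_n => y 0 u.2)); exact: (@coord_continuous R 1 n 0 _ x).
have /(cvgr_gt _ cx) : tcoord (v u.1.1) u.1.2 - tcoord (v u.1.1) u.2 <
  x 0 u.1.2 - x 0 u.2 by have := Qx u au; lra.
by apply: filterS => y yu; rewrite /Q; lra.
Qed.

(** Moving an interior point of the polytope close to [a] along the [k]-th axis
    keeps [r] in both types, although it changes the difference of the two
    coordinates. *)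
Lemma pure_types_not_single a k l r : pure (trop_polytope v) -> trop_polytope v a ->
  k != l -> trop_type v a k \subset [set r]%SET ->
  trop_type v a l \subset [set r]%SET -> False.
Proof.
move=> vp va kl kr lr; have [U [oU Ua] US] := trop_type_usc a.
have : closure (interior (trop_polytope v)) a by rewrite -vp.
move=> /(_ U (open_nbhs_nbhs (conj oU Ua)))[b [ib Ub]].
pose W := U `&` interior (trop_polytope v).
have oW : open W by apply: openI => //; exact: open_interior.
have tcW (x : 'rV[R]_n) : W (toTP x) ->
    x 0 k - x 0 l = tcoord (v r) k - tcoord (v r) l.
  move=> [/US xa /interior_subset/trop_polytopeP xv].
  have xr i : trop_type v a i \subset [set r]%SET -> r \in trop_type v (toTP x) i.
    move=> ir; have [s xs] := xv i.
    by have /(fintype.subsetP ir) := fintype.subsetP (xa i) _ xs; rewrite inE => /eqP <-.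
  have /mem_trop_type/(_ l) := xr k kr; have /mem_trop_type/(_ k) := xr l lr.
  by have [c xc] := tcoord_toTP x; rewrite !xc; lra.
have Wb : W b by [].
have [e e0 We] := open_TP_line (delta_mx 0 k) oW Wb.
have := tcW _ We; have := tcW (\row_i tcoord b i).
rewrite toTP_tcoord => /(_ Wb).
by rewrite !mxE !eqxx [l == k]eq_sym (negPf kl) /=; lra.
Qed.

End Generators.
End TropicalBasics.

Lemma all2_nth (T U : Type) (r : T -> U -> bool) (x0 : T) (y0 : U) (s : seq T)
    (t : seq U) : all2 r s t ->
  forall i, (i < size s)%N -> r (nth x0 s i) (nth y0 t i).
Proof.
elim: s t => [|x s IH] [|y t] //= /andP[xy st] [|i] //= si.
exact: IH.
Qed.

(** * General position and tight matchings *)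

Section GeneralPosition.
Context {R : realType} {n p : nat} (v : 'I_p -> TP R n).
Hypothesis vgp : general_position v.

Lemma ex_increasing_perm (m q : nat) (f : 'I_m -> 'I_q) : injective f ->
  exists s : 'S_m, {homo f \o s : i k / (i < k)%N}.
Proof.
move=> fi; pose t := [tuple f i | i < m].
have /tuple_permP[s st] : perm_eq (sort (relpre val leq) t) t by rewrite perm_sort.
exists s => i k ik.
have fE (l : 'I_m) : f (s l) = nth (f i) (sort (relpre val leq) t) l.
  by rewrite st nth_mktuple tnth_mktuple.
rewrite /= !fE; apply: (@sorted_ltn_nth _ (relpre val ltn)) => //.
- by move=> x y z; exact: ltn_trans.
- rewrite -sorted_map ltn_sorted_uniq_leq sorted_map sort_sorted ?andbT.
    by rewrite (map_inj_uniq val_inj) sort_uniq (map_inj_uniq fi) enum_uniq.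
  by move=> x y; exact: leq_total.
- by rewrite inE size_sort size_tuple.
- by rewrite inE size_sort size_tuple.
Qed.

(** Sorting rows and columns relabels the permutations by [phi] and preserves weights; this removes
    the monotonicity of the index maps. *)
Lemma general_position_inj (m : nat) (f : 'I_m -> 'I_n) (g : 'I_m -> 'I_p) :
  injective f -> injective g ->
  ~ trop_singular (mxsub f g (\matrix_(i, r) tcoord (v r) i)).
Proof.
move=> /ex_increasing_perm[s fs] /ex_increasing_perm[q gq] [u [t [ut um tm]]].
apply: (vgp fs gq); set U := mxsub f g _ in um tm; set U' := mxsub _ _ _.
pose phi (w : 'S_m) := (s * w * q^-1)%g.
have phiW w : trop_weight U' (phi w) = trop_weight U w.
  rewrite /trop_weight [RHS](reindex_inj (@perm_inj _ s)); apply: eq_bigr => i _.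
  by rewrite !mxE /= !permM permKV.
have phiK w : phi (s^-1 * w * q)%g = w by rewrite /phi !mulgA mulgV mul1g mulgK.
exists (phi u), (phi t); split.
- by apply: contra ut => /eqP /mulIg /mulgI ->.
- by move=> w; rewrite phiW -(phiK w) phiW.
- by move=> w; rewrite phiW -(phiK w) phiW.
Qed.

Lemma unique_max_weight (m : nat) (f : 'I_m -> 'I_n) (g : 'I_m -> 'I_p) :
  injective f -> injective g -> exists s : 'S_m, forall t, t != s ->
    \sum_i tcoord (v (g (t i))) (f i) < \sum_i tcoord (v (g (s i))) (f i).
Proof.
move=> fi gi; set U := mxsub f g (\matrix_(i, r) tcoord (v r) i).
have W (s : 'S_m) : \sum_i tcoord (v (g (s i))) (f i) = trop_weight U s.
  by apply: eq_bigr => i _; rewrite !mxE.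
have [s _ smax] := @arg_maxP _ _ _ (1%g : 'S_m) xpredT (trop_weight U) isT.
exists s => t ts; rewrite !W ltNge; apply/negP => st.
apply: (general_position_inj fi gi); exists t, s; split=> // u.
  by apply: le_trans st; exact: smax.
exact: smax.
Qed.

(** No permutation weighs more than the sum of the [M (g i)] plus that of the coordinates [f i] of
    [a], and tight matchings reach this bound. In general position only one permutation has maximal
    weight. *)
Lemma tight_matching_uniq (a : TP R n) (m : nat) (f : 'I_m -> 'I_n)
    (g : 'I_m -> 'I_p) (s t : 'S_m) : injective f -> injective g ->
  (forall i, g (s i) \in trop_type v a (f i)) ->
  (forall i, g (t i) \in trop_type v a (f i)) -> s = t.
Proof.
move=> fi gi sT tT; have [u umax] := unique_max_weight fi gi.
have tight (w : 'S_m) : (forall i, g (w i) \in trop_type v a (f i)) -> w = u.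
  move=> wT; apply/eqP; apply: contraT => /umax; rewrite ltNge => /negP; case.
  have [M MP] := ex_trop_level v a.
  have MX (x : 'S_m) : \sum_i M (g (x i)) = \sum_i M (g i).
    by rewrite [RHS](reindex_inj (@perm_inj _ x)).
  rewrite -(lerD2r (- \sum_i tcoord a (f i))) -!sumrB.
  apply: (@le_trans _ _ (\sum_i M (g (u i)))).
    by apply: ler_sum => i _; case: (MP (g (u i)) (f i)).
  rewrite MX -(MX w); apply: ler_sum => i _.
  by have [_] := MP (g (w i)) (f i); rewrite wT => /esym/eqP ->.
by rewrite (tight s)// (tight t).
Qed.

(** A cycle splits into two perfect matchings, here [xs] with [ys] and [xs] with [rot 1 ys]. Both
    are tight, so they coincide, but with at least two distinct entries the rotation is not
    trivial. *)
Lemma no_tight_cycle (a : TP R n) (m : nat) (xs : m.+2.-tuple 'I_n)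
    (ys : m.+2.-tuple 'I_p) : uniq xs -> uniq ys ->
  all2 (fun i r => r \in trop_type v a i) xs ys ->
  all2 (fun i r => r \in trop_type v a i) xs (rot 1 ys) -> False.
Proof.
move=> ux uy h1 h2.
have tnth_all2 (s : m.+2.-tuple _) (t : m.+2.-tuple _) :
    all2 (fun i r => r \in trop_type v a i) s t ->
    forall i, tnth t i \in trop_type v a (tnth s i).
  move=> st i; rewrite (tnth_nth (tnth s i)) (tnth_nth (tnth t i)).
  by apply: all2_nth st _ _; rewrite size_tuple.
have /tuple_permP[s sE] : perm_eq (rot 1 ys) ys by rewrite perm_rot.
have s1 : s = 1%g.
  apply: (@tight_matching_uniq a _ (tnth xs) (tnth ys)) => [||i|i].
  - exact/tuple_uniqP.
  - exact/tuple_uniqP.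
  - have -> : tnth ys (s i) = tnth [tuple of rot 1 ys] i.
      by rewrite [RHS](tnth_nth (tnth ys i)) /= sE nth_mktuple.
    exact: tnth_all2.
  - by rewrite perm1; exact: tnth_all2.
move/(congr1 (fun w => nth (tnth ys 0) w 0)): sE.
rewrite (nth_mktuple _ _ (0 : 'I_m.+2)) s1 perm1.
case: ys uy {tnth_all2 h1 h2 s1 s} => -[|y [|y' ys]] //= sz + yE.
by rewrite (tnth_nth y) /= in yE; rewrite /rot /= in yE; rewrite yE inE eqxx.
Qed.

End GeneralPosition.

(** * Images of half-spaces under the valuation *)

Section ValuationOfHalfspaces.
Context {R : realType} {n : nat}.
Implicit Types (f x : 'rV[hahn R]_n).

Lemma tcoord_vec_val x : positive_vec x -> exists c, forall i,
  tcoord (vec_val x) i = c - minexp (x 0 i).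
Proof.
move=> x0; have [c xc] := tcoord_toTP (\row_i fine (hval (x 0 i))).
by exists c => i; rewrite xc mxE /hval gt_eqF//= addrC.
Qed.

Lemma lead_at (y : hahn R) e e' c : lead y e c -> e' <= e ->
  lead y e' (if e == e' then c else 0).
Proof.
move=> ye; rewrite le_eqVlt eq_sym; case: eqVneq => [<- //|_ /=].
exact: lead_weak ye.
Qed.

Lemma vec_val_lead x (a : TP R n) (d : 'I_n -> R) :
  (forall i, lead (x 0 i) (- tcoord a i) (d i)) -> (forall i, 0 < d i) ->
  positive_vec x /\ vec_val x = a.
Proof.
move=> xd d0; have x0 i : 0 < x 0 i by exact: lead_gt0 (xd i) _.
split=> //; rewrite -[RHS]toTP_tcoord; congr toTP; apply/rowP => i.
rewrite [LHS]mxE [RHS]mxE /hval gt_eqF ?x0//.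
by rewrite (minexp_lead (xd i)) ?gt_eqF//= opprK.
Qed.

(** The terms of least exponent decide the sign of the sum. If all of them are negative, nothing can
    cancel them; if one is positive, a lift of [b] with a large enough coefficient there makes it
    dominate. *)
Lemma val_image_halfspace f : (0 < n)%N -> (forall i, f 0 i != 0) ->
  val_image (halfspace f) =
  trop_halfspace (toTP (\row_i minexp (f 0 i))) [set i | 0 < f 0 i]%SET.
Proof.
move=> n0 f0; set I := [set i | _]%SET; set a := toTP _.
pose lc i := f 0 i (minexp (f 0 i)).
have lcf i : lead (f 0 i) (minexp (f 0 i)) (lc i) by exact: lead_minexp.
have lcI i : i \in I -> 0 < lc i by rewrite inE hahn_gt0.
have lcJ i : i \notin I -> lc i < 0.
  by rewrite inE -leNgt le_eqVlt (negPf (f0 i)) /= hahn_lt0.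
have [c ac] : exists c, forall i, tcoord a i = minexp (f 0 i) + c.
  by have [c h] := tcoord_toTP (\row_i minexp (f 0 i)); exists c => i; rewrite h mxE.
rewrite predeqE => b; rewrite trop_halfspaceP; split.
- move=> [x [fx x0] <-] j0 j0I; have [d xd] := tcoord_vec_val x0.
  pose E i := minexp (f 0 i) + minexp (x 0 i).
  apply: contrapT => nI.
  have [j jI jmin] := @arg_minP _ _ _ j0 [pred i | i \notin I] E j0I.
  have EI i : i \in I -> E j < E i.
    move=> iI; apply: (le_lt_trans (jmin _ j0I)); rewrite ltNge; apply/negP => ij.
    by apply: nI; exists i => //; move: ij; rewrite /E !xd !ac; lra.
  have Ej i : E j <= E i.
    by have [/EI/ltW//|/jmin] := boolP (i \in I).
  have lfx i : lead (f 0 i * x 0 i) (E j)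
      (if E i == E j then lc i * (x 0 i) (minexp (x 0 i)) else 0).
    by apply: lead_at; [apply: leadM; exact: lead_minexp|].
  have := @lead_sum _ _ (index_enum 'I_n) xpredT _ _ _ (fun i _ => lfx i).
  move=> /lead_ge0/(_ fx); apply/negP; rewrite -ltNge (bigD1 j)//= eqxx.
  rewrite -[ltRHS]addr0; apply: ltr_leD.
    by rewrite nmulr_rlt0 ?lcJ// -hahn_gt0.
  apply: sumr_le0 => i _; case: ifPn => // /eqP Eij.
  have [/EI|/lcJ iJ] := boolP (i \in I); first by rewrite Eij ltxx.
  by rewrite nmulr_rle0 // ltW// -hahn_gt0.
- move=> hb; pose E i := minexp (f 0 i) - tcoord b i.
  (* A global minimiser outside [I] is replaced by the index of [I] that the half-space inequality
     provides for it. *)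
  have [i0 i0I Ei0] : exists2 i0, i0 \in I & forall l, E i0 <= E l.
    have [i1 i1m] := ex_argmax (fun i => - E i) (Ordinal n0).
    have {}i1m l : E i1 <= E l by rewrite -lerN2.
    have [|/hb[i iI ij]] := boolP (i1 \in I); first by exists i1.
    exists i => // l; apply: le_trans (i1m l).
    by move: ij; rewrite /E !ac; lra.
  (* With this [M] the term at [i0] is [1 + B], which outweighs all negative leading coefficients of
     [f] together. *)
  pose B := \sum_i `|lc i|; pose M := (1 + B) / lc i0.
  have B0 : 0 <= B by apply: sumr_ge0 => i _; exact: normr_ge0.
  have M0 : 0 < M by rewrite divr_gt0 ?lcI// ltr_wpDr.
  pose m i := if i \in I then M else 1.
  have m0 i : 0 < m i by rewrite /m; case: ifP.
  pose x : 'rV[hahn R]_n := \row_i hmonom (m i) (- tcoord b i).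
  have lx i : lead (x 0 i) (- tcoord b i) (m i) by rewrite mxE; exact: lead_monom.
  have [x0 xb] := vec_val_lead lx m0; exists x => //.
  split=> //; have lfx i : lead (f 0 i * x 0 i) (E i0)
      (if E i == E i0 then lc i * m i else 0).
    by apply: lead_at; [exact: leadM|exact: Ei0].
  have := @lead_sum _ _ (index_enum 'I_n) xpredT _ _ _ (fun i _ => lfx i).
  move=> /lead_gt0 h; apply/ltW/h; rewrite (bigD1 i0)//= eqxx /m i0I.
  have -> : lc i0 * M = 1 + B by rewrite mulrC divfK// gt_eqF// lcI.
  rewrite -addrA ltr_pwDl// /B (bigD1 i0)//= -addrA.
  rewrite addr_ge0// -big_split /= sumr_ge0// => i _.
  case: ifP => _; last by rewrite addr0.
  have [iI|iI] := boolP (i \in I).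
    by rewrite addr_ge0// mulr_ge0 // ?ltW// lcI.
  by rewrite mulr1; have := ler_norm (- lc i); rewrite normrN; lra.
Qed.

End ValuationOfHalfspaces.

(** * Non-vanishing minors of a lift *)

Section LiftMinors.
Context {R : realType} {n p : nat} (v : 'I_p -> TP R n).
Context (V : 'I_p -> 'rV[hahn R]_n).
Hypothesis vgp : general_position v.
Hypothesis V0 : forall r, positive_vec (V r).
Hypothesis Vv : forall r, vec_val (V r) = v r.

Lemma lift_minexp : exists c : 'I_p -> R, forall r i,
  minexp (V r 0 i) = c r - tcoord (v r) i.
Proof.
suff /boolp.choice[c cP] : forall r, exists c, forall i,
    minexp (V r 0 i) = c - tcoord (v r) i by exists c.
move=> r; have [c cP] := tcoord_vec_val (V0 r).
by exists c => i; rewrite -Vv cP subKr.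
Qed.

(** The permutation of maximal tropical weight contributes the only term of
    least exponent to the expansion of the determinant. *)
Lemma lift_minor_neq0 (m : nat) (f : 'I_m -> 'I_n) (g : 'I_m -> 'I_p) :
  injective f -> injective g -> \det (\matrix_(i, l) V (g l) 0 (f i)) != 0.
Proof.
move=> fi gi; have [s smax] := unique_max_weight vgp fi gi.
have [c cP] := lift_minexp.
pose w (t : 'S_m) := \sum_i tcoord (v (g (t i))) (f i).
pose d (t : 'S_m) := \prod_i V (g (t i)) 0 (f i) (minexp (V (g (t i)) 0 (f i))).
have lt (t : 'S_m) : lead (\prod_i V (g (t i)) 0 (f i)) (\sum_i c (g i) - w t) (d t).
  have -> : \sum_i c (g i) - w t = \sum_i minexp (V (g (t i)) 0 (f i)).
    rewrite (reindex_inj (@perm_inj _ t)) /= -sumrB.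
    by apply: eq_bigr => i _; rewrite cP.
  by apply: lead_prod => i _; exact: lead_minexp.
have lts (t : 'S_m) : lead ((-1) ^+ t * \prod_i V (g (t i)) 0 (f i))
    (\sum_i c (g i) - w s) (if t == s then (-1) ^+ t * d t else 0).
  rewrite !mulr_sign; have [->|ts] := eqVneq t s.
    by case: ifP => _; [apply: leadN|]; exact: lt.
  have h : lead (\prod_i V (g (t i)) 0 (f i)) (\sum_i c (g i) - w s) 0.
    by apply: lead_weak (lt t) _; rewrite ltrD2l ltrN2 smax.
  by case: ifP => _ //; rewrite -[X in lead _ _ X]oppr0; exact: leadN.
rewrite /determinant.
rewrite (eq_bigr (fun t : 'S_m => (-1) ^+ t * \prod_i V (g (t i)) 0 (f i))); last first.
  by move=> t _; congr (_ * _); apply: eq_bigr => i _; rewrite mxE.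
have /lead_neq0 := @lead_sum _ _ (index_enum 'S_m) xpredT _ _ _ (fun t _ => lts t).
apply; rewrite -big_mkcond big_pred1_eq mulf_neq0 ?signr_eq0//.
by apply/prodf_neq0 => i _; rewrite gt_eqF// -hahn_gt0; exact: V0.
Qed.

(** Without coordinate [k] there remain [n.-1] unknowns and [n.-1] independent equations, by the
    non-vanishing minor. Hence facet normals have no zero coordinate and are determined up to a
    scalar. *)
Lemma orthogonal_eq0 (X : {set 'I_p}) (f : 'rV[hahn R]_n) k :
  (n.-1 <= #|X|)%N -> (forall r, r \in X -> \sum_i f 0 i * V r 0 i = 0) ->
  f 0 k = 0 -> f = 0.
Proof.
move=> nX fX fk; pose g (i : 'I_n.-1) : 'I_p := enum_val (widen_ord nX i).
have gi : injective g by move=> i l /enum_val_inj/(congr1 val)/= /val_inj.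
have /det0P dA := lift_minor_neq0 (@lift_inj _ k) gi.
have fl0 : \row_(i < n.-1) f 0 (lift k i) = 0.
  apply/eqP; apply: contraT => fl; exfalso; apply: dA; exists (\row_i f 0 (lift k i)) => //.
  apply/rowP => l; rewrite !mxE -[RHS](fX (g l)); last exact: enum_valP.
  rewrite [RHS](bigD1_ord k)//= fk mul0r add0r.
  by apply: eq_bigr => i _; rewrite !mxE.
apply/rowP => i; rewrite !mxE; case: (unliftP k i) => [l ->|-> //].
by move/rowP: fl0 => /(_ l); rewrite !mxE.
Qed.

End LiftMinors.

(** * Faces of a finitely generated cone *)

Section FacesOfCones.
Context {K : realFieldType} {n p : nat}.
Implicit Types (f : 'rV[K]_n) (V : 'I_p -> 'rV[K]_n).

Definition zero_set V f := [set r | \sum_i f 0 i * V r 0 i == 0]%SET.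

Lemma dot_comb V f (c : 'I_p -> K) :
  \sum_i f 0 i * (\sum_r c r *: V r) 0 i = \sum_r c r * \sum_i f 0 i * V r 0 i.
Proof.
under eq_bigr do rewrite summxE mulr_sumr.
rewrite exchange_big /=; apply: eq_bigr => r _; rewrite mulr_sumr.
by apply: eq_bigr => i _; rewrite mxE mulrCA.
Qed.

Lemma cone_generator V r : cone V (V r).
Proof.
exists (fun s => (s == r)%:R) => [s|]; first exact: ler0n.
rewrite (bigD1 r)//= eqxx scale1r big1 ?addr0// => s /negPf ->.
by rewrite scale0r.
Qed.

Lemma cone_halfspaceP V f : cone V `<=` halfspace f <->
  forall r, 0 <= \sum_i f 0 i * V r 0 i.
Proof.
split=> [h r|h x [c c0 ->]]; first exact: h (cone_generator V r).
rewrite /halfspace /= dot_comb sumr_ge0// => r _.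
by rewrite mulr_ge0.
Qed.

(** On the hyperplane a sum of non-negative terms vanishes, so each term does, and only generators
    on the hyperplane contribute. *)
Lemma face_span V f x : cone V `<=` halfspace f ->
  (cone V `&` hyperplane f) x -> x \in <<[seq V r | r <- enum (zero_set V f)]>>%VS.
Proof.
move=> /cone_halfspaceP Vf [[c c0 ->]]; rewrite /hyperplane /= dot_comb => cf.
have {}cf r : c r * \sum_i f 0 i * V r 0 i = 0.
  by apply: (psumr_eq0P _ cf) => // s _; rewrite mulr_ge0.
apply: memv_suml => r _; have [rX|rX] := boolP (r \in zero_set V f).
  by apply/memvZ/memv_span/map_f; rewrite mem_enum.
have /eqP := cf r; rewrite mulf_eq0 => /orP[/eqP ->|r0].
- by rewrite scale0r mem0v.
- by rewrite inE r0 in rX.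
Qed.

Lemma facet_zero_set V f d : cone V `<=` halfspace f ->
  has_dim (cone V `&` hyperplane f) d -> (d <= #|zero_set V f|)%N.
Proof.
move=> Vf [U [_ Umin <-]]; apply: leq_trans (dimvS (Umin _ (fun x => @face_span V f x Vf))) _.
by apply: leq_trans (dim_span _) _; rewrite size_map -cardE.
Qed.

End FacesOfCones.

(** * Facet images are finitely many tropical half-spaces containing the polytope *)

Section FacetImages.
Context {R : realType} {n p : nat} (v : 'I_p -> TP R n).
Context (V : 'I_p -> 'rV[hahn R]_n).
Hypothesis n2 : (2 <= n)%N.
Hypothesis vgp : general_position v.
Hypothesis V0 : forall r, positive_vec (V r).
Hypothesis Vv : forall r, vec_val (V r) = v r.

(** Once coordinate [i] is rescaled by [t ^ (tcoord a i)], all entries of [V r] have exponents at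
    least [mu r], with equality exactly where [r] is in the type. Sign questions then reduce to the
    reals [d r i]. *)
Lemma lift_lead (a : TP R n) : exists (mu : 'I_p -> R) (d : 'I_p -> 'I_n -> R),
  forall r i, lead (V r 0 i) (mu r - tcoord a i) (d r i) /\
    (if r \in trop_type v a i then 0 < d r i else d r i == 0).
Proof.
have [c cP] := lift_minexp V0 Vv; have [M MP] := ex_trop_level v a.
pose d r i := if r \in trop_type v a i then V r 0 i (minexp (V r 0 i)) else 0.
exists (fun r => c r - M r), d => r i; split; last first.
  rewrite /d; case: ifP => ri; rewrite ri // -hahn_gt0; exact: V0.
have [leM eqM] := MP r i; rewrite /d eqM.
have -> : (tcoord (v r) i - tcoord a i == M r) =
    (minexp (V r 0 i) == c r - M r - tcoord a i).
  by rewrite cP; apply/eqP/eqP; lra.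
by apply: lead_at; [exact: lead_minexp|rewrite cP; lra].
Qed.

(** The multipliers [t ^ (- mu r)] align all generators with [a]. The leading coefficients are
    non-negative, with a positive one in each coordinate, so nothing cancels and the combination is
    a lift of [a] in the cone. *)
Lemma polytope_sub_val_image f : cone V `<=` halfspace f ->
  trop_polytope v `<=` val_image (halfspace f).
Proof.
move=> Vf a /trop_polytopeP va; have [mu [d dP]] := lift_lead a.
pose x := \sum_r hmonom 1 (- mu r) *: V r.
have lx i : lead (x 0 i) (- tcoord a i) (\sum_r d r i).
  rewrite summxE; apply: lead_sum => r _; rewrite mxE -[d r i]mul1r.
  rewrite -[- tcoord a i](addKr (mu r)).
  by apply: leadM; [exact: lead_monom|case: (dP r i)].
have d0 r i : 0 <= d r i.
  by have [_] := dP r i; case: ifP => _ => [/ltW|/eqP->].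
have dsum i : 0 < \sum_r d r i.
  have [r ri] := va i; rewrite (bigD1 r)//=; apply: ltr_wpDr.
    by apply: sumr_ge0.
  by have [_] := dP r i; rewrite ri.
have [x0 xa] := vec_val_lead lx dsum; exists x => //; split=> //.
apply: Vf; exists (fun r => hmonom 1 (- mu r)) => // r.
exact: ltW (lead_gt0 (lead_monom _ _) _).
Qed.

Lemma facet_coord_neq0 f k : f != 0 -> (n.-1 <= #|zero_set V f|)%N -> f 0 k != 0.
Proof.
move=> f0 nX; apply: contra f0 => /eqP fk; apply/eqP.
by apply: (orthogonal_eq0 vgp V0 Vv nX _ fk) => r; rewrite inE => /eqP.
Qed.

(** A positive generator on the hyperplane prevents the non-zero coordinates of [f] from all having
    the same sign. *)
Lemma facet_image_halfspace f : f != 0 -> (n.-1 <= #|zero_set V f|)%N ->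
  is_trop_halfspace (val_image (halfspace f)).
Proof.
move=> f0 nX; have fk k := facet_coord_neq0 k f0 nX.
exists (toTP (\row_i minexp (f 0 i))), [set i | 0 < f 0 i]%SET; split; last first.
  by apply: val_image_halfspace => //; exact: ltnW.
have /card_gt0P[r] : (0 < #|zero_set V f|)%N.
  by apply: leq_trans nX; rewrite -subn1 subn_gt0.
rewrite inE => /eqP fr; have k0 : 'I_n := Ordinal (ltnW n2).
split; apply/eqP => /setP I.
- suff : \sum_i f 0 i * V r 0 i < 0 by rewrite fr ltxx.
  have fi i : f 0 i * V r 0 i < 0.
    have := I i; rewrite !inE ltNge => /negbFE fi.
    by rewrite nmulr_rlt0 ?V0// lt_neqAle fi fk.
  by rewrite (bigD1 k0)//= ltr_wnDr// sumr_le0// => i _; exact: ltW.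
- suff : 0 < \sum_i f 0 i * V r 0 i by rewrite fr ltxx.
  have fi i : 0 < f 0 i * V r 0 i.
    by have := I i; rewrite !inE => fi; rewrite mulr_gt0// V0.
  by rewrite (bigD1 k0)//= ltr_wpDr// sumr_ge0// => i _; exact: ltW.
Qed.

(** The vector [g 0 k *: f - f 0 k *: g] vanishes at [k] and is orthogonal to the common generators,
    hence is zero; equal signs at [k] make the ratio positive. *)
Lemma facet_halfspace_uniq f g k : f != 0 -> g != 0 ->
  (n.-1 <= #|zero_set V f|)%N -> zero_set V f = zero_set V g ->
  (0 < f 0 k) = (0 < g 0 k) -> halfspace f = halfspace g.
Proof.
move=> f0 g0 nX fgX fgk; have fk := facet_coord_neq0 k f0 nX.
have gk : g 0 k != 0 by apply: facet_coord_neq0 g0 _; rewrite -fgX.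
have h0 : g 0 k *: f - f 0 k *: g = 0.
  apply: (orthogonal_eq0 vgp V0 Vv (k := k) nX) => [r rX|].
    have := rX; rewrite fgX inE => /eqP gr; move: rX; rewrite inE => /eqP fr.
    transitivity (g 0 k * (\sum_i f 0 i * V r 0 i) -
                  f 0 k * (\sum_i g 0 i * V r 0 i)).
      rewrite !mulr_sumr -sumrB; apply: eq_bigr => i _.
      by rewrite !mxE mulrBl !mulrA.
    by rewrite fr gr !mulr0 subrr.
  by rewrite !mxE mulrC subrr.
have fE i : f 0 i = (f 0 k / g 0 k) * g 0 i.
  move/rowP/(_ i): h0; rewrite !mxE => /eqP; rewrite subr_eq0 => /eqP h.
  by rewrite mulrAC -h mulrAC mulfV// mul1r.
have c0 : 0 < f 0 k / g 0 k.
  have [gk0|gk0] := boolP (0 < g 0 k); first by rewrite divr_gt0 ?fgk.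
  have fk0 : f 0 k < 0 by rewrite lt_neqAle fk leNgt fgk.
  by rewrite nmulr_rgt0// invr_lt0 lt_neqAle gk leNgt.
rewrite /halfspace predeqE => x /=; under eq_bigr do rewrite fE -mulrA.
by rewrite -mulr_sumr pmulr_rge0.
Qed.

Lemma facet_definingP H : facet_defining (cone V) H -> exists f,
  [/\ f != 0, H = halfspace f, cone V `<=` halfspace f &
      (n.-1 <= #|zero_set V f|)%N].
Proof.
move=> [f [f0 -> Vf [_ /(facet_zero_set Vf)]]]; by exists f.
Qed.

(** A zero set and the sign of one coordinate determine the half-space. *)
Lemma finite_facet_images : finite_set (facet_images (cone V)).
Proof.
pose k0 : 'I_n := Ordinal (ltnW n2).
pose Q (u : {set 'I_p} * bool) (f : 'rV[hahn R]_n) :=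
  [/\ f != 0, zero_set V f = u.1 & (0 < f 0 k0) = u.2].
have [G GP] : exists G, forall u f, Q u f -> Q u (G u).
  by exists (fun u => xget 0 (Q u)) => u f uf; apply: xgetPex; exists f.
apply: (@sub_finite_set _ _ ((fun u => val_image (halfspace (G u))) @` [set: _])).
  move=> _ [_ /facet_definingP[f [f0 -> _ nX]] <-].
  exists (zero_set V f, 0 < f 0 k0); first exact: I.
  have [g0 gX gk] : Q (zero_set V f, 0 < f 0 k0) (G (zero_set V f, 0 < f 0 k0)).
    by apply: (GP _ f); split.
  apply: (congr1 val_image); apply/esym/(@facet_halfspace_uniq _ _ k0) => //.
exact: finite_image.
Qed.

End FacetImages.

(** * The tree of generators at a pseudovertex *)

Section PseudovertexTree.
Context {R : realType} {n p : nat} (v : 'I_p -> TP R n).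
Hypothesis vgp : general_position v.
Hypothesis vpure : pure (trop_polytope v).
Context (I : {set 'I_n}) (j : 'I_n) (a : TP R n).
Hypothesis jI : j \notin I.
Hypothesis aI : pseudovertex v I j a.
Let S := trop_type v a.

Let ex_nbrI r : exists2 i, i \in I & r \in S i.
Proof.
have [/setP/(_ r) + _ _] := aI; rewrite finset.in_setT => /bigcupP[i iI ri].
by exists i.
Qed.

(** For [i] in [I] the generator comes from the third condition on pseudovertices, for the other
    coordinates from the second. *)
Let ex_tau : exists tau : 'I_n -> 'I_p, (forall i, tau i \in S i) /\
  forall i, i \in I -> tau i \in S j /\ forall h, h \in I -> tau i \in S h -> h = i.
Proof.
suff /boolp.choice[tau tauP] : forall i, exists r, r \in S i /\ (i \in I ->
    r \in S j /\ forall h, h \in I -> r \in S h -> h = i).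
  by exists tau; split=> i; case: (tauP i).
move=> i; have [_ h2 h3] := aI; have [iI|iI] := boolP (i \in I).
- have /subsetPn[r] := h3 i iI; rewrite inE => /andP[ri rj] /bigcupP nr.
  exists r; split=> // _; split=> // h hI rh; apply/eqP; apply: contraT => hi.
  by exfalso; apply: nr; exists h => //; rewrite !inE hi.
- have [h _ /set0Pn[r]] := h2 i iI; rewrite inE => /andP[_ ri].
  by exists r.
Qed.

(** The bipartite graph joining each generator [r] to the coordinates [l] with
    [r \in S l] is a tree rooted at [j]; each edge [l - par l] of the tree
    obtained by forgetting the generators of degree one is carried by the
    generator [tau l]. *)
Lemma pseudovertex_tree : exists (tau : 'I_n -> 'I_p) (par : 'I_n -> 'I_n),
  [/\ forall i, i \in I -> par i = j,
      forall k, k \notin I -> k != j -> par k \in I,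
      forall l m, l != j -> (tau l \in S m) = (m == l) || (m == par l) &
      forall r k, r \in S k -> k \notin I -> exists2 l, l != j & r = tau l].
Proof.
have [tau [tauS tauI]] := ex_tau.
have neI i k : i \in I -> k \notin I -> i != k.
  by move=> iI; apply: contraNneq => <-.
have tau_inj i h : i \in I -> h \in I -> i != h -> tau i != tau h.
  move=> iI hI; apply: contra_neq => ih.
  by have [_] := tauI _ hI; apply => //; rewrite -ih.
(* Otherwise [i], [tau i], [j], [tau h], [h], [r] form a cycle. *)
have uniqI r i h : i \in I -> h \in I -> r \in S i -> r \in S h -> i = h.
  move=> iI hI ri rh; apply/eqP; apply: contraT => ih; exfalso.
  have ri' : r != tau i.
    by apply: contra_neq ih => rE; apply/esym/(proj2 (tauI _ iI)); rewrite -?rE.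
  have rh' : r != tau h.
    by apply: contra_neq ih => rE; apply: (proj2 (tauI _ hI)); rewrite -?rE.
  apply: (@no_tight_cycle _ _ _ _ vgp a 1 [tuple i; h; j] [tuple tau i; r; tau h]).
  - by rewrite /= !inE negb_or ih !neI.
  - by rewrite /= !inE negb_or eq_sym ri' rh' tau_inj.
  - by rewrite /= tauS rh (proj1 (tauI _ hI)).
  - by rewrite /= ri tauS (proj1 (tauI _ iI)).
have nbrj r i : i \in I -> r \in S j -> r \in S i -> r = tau i.
  move=> iI rj ri; apply/eqP; apply: contraT => ri'; exfalso.
  apply: (@no_tight_cycle _ _ _ _ vgp a 0 [tuple i; j] [tuple r; tau i]).
  - by rewrite /= !inE neI.
  - by rewrite /= !inE ri'.
  - by rewrite /= ri (proj1 (tauI _ iI)).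
  - by rewrite /= rj tauS.
(* Two generators at [k] would both lead through [I] to [j]; the two paths contain a cycle of length
   4, 6 or 8, depending on which vertices coincide. *)
have nbrJ k r s : k \notin I -> k != j -> r \in S k -> s \in S k -> r = s.
  move=> kI kj rk sk; apply/eqP; apply: contraT => rs; exfalso.
  have [i iI ri] := ex_nbrI r; have [h hI sh] := ex_nbrI s.
  have [ih|ih] := eqVneq i h.
    apply: (@no_tight_cycle _ _ _ _ vgp a 0 [tuple i; k] [tuple r; s]).
    - by rewrite /= !inE neI.
    - by rewrite /= !inE rs.
    - by rewrite /= ri sk.
    - by rewrite /= ih sh rk.
  have jk : j != k by rewrite eq_sym.
  have six r' s' i' h' : r' != s' -> i' \in I -> h' \in I -> i' != h' ->
      r' \in S k -> s' \in S k -> s' \in S h' -> r' = tau i' -> s' != tau h' -> False.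
    move=> rs' iI' hI' ih' rk' sk' sh' rE sE.
    apply: (@no_tight_cycle _ _ _ _ vgp a 1 [tuple j; h'; k] [tuple r'; tau h'; s']).
    - by rewrite /= !inE negb_or eq_sym (neI h' j)// jk (neI h' k).
    - by rewrite /= !inE negb_or rs' rE tau_inj// [tau h' == _]eq_sym sE.
    - by rewrite /= rE (proj1 (tauI _ iI')) tauS sk'.
    - by rewrite /= (proj1 (tauI _ hI')) sh' rk'.
  have [rE|rE] := eqVneq r (tau i); have [sE|sE] := eqVneq s (tau h).
  - apply: (@no_tight_cycle _ _ _ _ vgp a 0 [tuple j; k] [tuple r; s]).
    + by rewrite /= !inE jk.
    + by rewrite /= !inE rs.
    + by rewrite /= rE (proj1 (tauI _ iI)) sk.
    + by rewrite /= sE (proj1 (tauI _ hI)) rk.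
  - exact: (six r s i h).
  - by apply: (six s r h i); rewrite // eq_sym.
  - have rh : r != tau h.
      by apply: contra_neq ih => E; apply: (uniqI r); rewrite // E.
    have si : s != tau i.
      by apply: contra_neq ih => E; apply: (uniqI s); rewrite // E.
    apply: (@no_tight_cycle _ _ _ _ vgp a 2 [tuple i; j; h; k]
      [tuple r; tau i; tau h; s]).
    + by rewrite /= !inE !negb_or ih jk [j == h]eq_sym (neI i j)// (neI i k)//
        (neI h j)// (neI h k).
    + by rewrite /= !inE !negb_or rs rh rE tau_inj//= [tau i == s]eq_sym si eq_sym sE.
    + by rewrite /= ri tauS sk (proj1 (tauI _ iI)).
    + by rewrite /= tauS sh rk (proj1 (tauI _ hI)).
have va : trop_polytope v a by apply/trop_polytopeP => i; exists (tau i).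
(* By [nbrJ], both types would reduce to [r], which purity at [a] forbids. *)
have childJ k l r : k \notin I -> k != j -> l \notin I -> l != j ->
    r \in S k -> r \in S l -> k = l.
  move=> kI kj lI lj rk rl; apply/eqP; apply: contraT => kl; exfalso.
  apply: (@pure_types_not_single _ _ _ v a k l r) => //; apply/fintype.subsetP => s sk;
    rewrite inE; apply/eqP; [exact: (nbrJ k)|exact: (nbrJ l)].
have leafJ i k : i \in I -> k \notin I -> k != j -> tau i \notin S k.
  move=> iI kI kj; apply/negP => ik.
  (* Lowering the coordinates in [B] keeps the apex in the polytope, but makes
     [tau i] the only generator adjacent to [j] and to [k]. *)
  pose B := [set l | (l != j) && [exists r, (r \in S l) && (r \notin S i)]]%SET.
  have BP r l : r \in S i -> l \in B -> r \notin S l.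
    move=> ri; rewrite inE => /andP[lj /existsP[s /andP[sl si]]].
    apply: contra si => rl; have [lI|lI] := boolP (l \in I).
      by rewrite (uniqI r i l).
    by rewrite (nbrJ l s r).
  have jB : j \notin B by rewrite inE eqxx.
  have [U [oU Ua] US] := trop_type_usc v a.
  have [e e0] := open_TP_line (- \row_l (l \in B)%:R) oU Ua.
  set x := _ + _; move=> /US; set a' := toTP x => a'S.
  have [c a'E] : exists c, forall l, tcoord a' l = tcoord a l - e * (l \in B)%:R + c.
    by have [c h] := tcoord_toTP x; exists c => l; rewrite h !mxE mulrN.
  have a'B r l : r \in S l -> l \in B -> r \in trop_type v a' l.
    move=> /mem_trop_type rl lB; apply/mem_trop_type => m.
    have := rl m; rewrite !a'E lB; case: (m \in B) => /=; lra.
  have a'nB r l : r \in S l -> (forall m, m \in B -> r \notin S m) ->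
      r \in trop_type v a' l.
    move=> rl rB; have lB : l \notin B by apply: contraL rl; exact: rB.
    have [m mm] := ex_argmax (fun m => tcoord (v r) m - tcoord a' m) j.
    have rm : r \in S m.
      by apply: (fintype.subsetP (a'S m)); apply/mem_trop_type.
    have mB : m \notin B by apply: contraL rm; exact: rB.
    apply/mem_trop_type => q; apply: le_trans (mm q) _.
    move/mem_trop_type: rl => /(_ m); rewrite !a'E (negPf lB) (negPf mB); lra.
  have va' : trop_polytope v a'.
    apply/trop_polytopeP => l; have [lB|lB] := boolP (l \in B).
      by exists (tau l); exact: a'B.
    have [->|lj] := eqVneq l j.
      exists (tau i); apply: a'nB; first exact: (proj1 (tauI _ iI)).
      by move=> m; exact: BP.
    exists (tau l); apply: a'nB => // m; apply: BP.
    move: lB; rewrite inE lj /= negb_exists => /forallP/(_ (tau l)).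
    by rewrite tauS negbK.
  apply: (@pure_types_not_single _ _ _ v a' j k (tau i)) => //; first by rewrite eq_sym.
  - apply/fintype.subsetP => r rj; rewrite inE.
    have rj' : r \in S j by exact: (fintype.subsetP (a'S j)).
    have [h hI rh] := ex_nbrI r; have [<-|hi] := eqVneq h i.
      exact/eqP/nbrj.
    (* Since [h] is lowered and [j] is not, [r] loses its edge to [j]. *)
    have hB : h \in B.
      rewrite inE neI//=; apply/existsP; exists r; rewrite rh /=.
      by apply: contra hi => ri; apply/eqP; exact: (uniqI r).
    move/mem_trop_type: rj => /(_ h); move/mem_trop_type: rh => /(_ j).
    by rewrite !a'E hB (negPf jB) /=; lra.
  - apply/fintype.subsetP => r /(fintype.subsetP (a'S k)) rk.
    by rewrite inE; apply/eqP/(nbrJ k).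
(* The default [j] of [xget] is never taken, because every generator meets [I]. *)
pose par l := if l \in I then j else xget j [set i | i \in I /\ tau l \in S i].
have parJ l : l \notin I -> par l \in I /\ tau l \in S (par l).
  move=> lI; rewrite /par (negPf lI); case: xgetP => [i _ //|ni].
  by have [i iI li] := ex_nbrI (tau l); exfalso; apply: (ni i).
exists tau, par; split.
- by move=> i iI; rewrite /par iI.
- by move=> k /parJ[].
- move=> l m lj; apply/idP/orP => [lm|[] /eqP -> //]; last first.
    have [lI|/parJ[]//] := boolP (l \in I).
    by rewrite /par lI; case: (tauI _ lI).
  have [lI|lI] := boolP (l \in I).
    have [mI|mI] := boolP (m \in I).
      by left; apply/eqP/(uniqI (tau l)).
    have [->|mj] := eqVneq m j; first by right; rewrite /par lI.
    by have := leafJ l m lI mI mj; rewrite lm.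
  have [pI lp] := parJ l lI; have [mI|mI] := boolP (m \in I).
    by right; apply/eqP/(uniqI (tau l)).
  have [mj|mj] := eqVneq m j; last by left; apply/eqP/(childJ _ _ (tau l)).
  have := leafJ _ l pI lI lj; rewrite -(nbrj (tau l) (par l)) ?tauS// -mj.
  exact: lm.
- move=> r k rk kI; have [kj|kj] := eqVneq k j.
    have [i iI ri] := ex_nbrI r; exists i; first exact: neI.
    by apply: nbrj => //; rewrite -kj.
  by exists k => //; exact: (nbrJ k).
Qed.

End PseudovertexTree.

(** * The facet defined by a pseudovertex *)

Section PseudovertexFacet.
Context {R : realType} {n p : nat} (v : 'I_p -> TP R n).
Context (V : 'I_p -> 'rV[hahn R]_n).
Hypothesis n2 : (2 <= n)%N.
Hypothesis vgp : general_position v.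
Hypothesis vpure : pure (trop_polytope v).
Hypothesis V0 : forall r, positive_vec (V r).
Hypothesis Vv : forall r, vec_val (V r) = v r.
Context (I : {set 'I_n}) (j : 'I_n) (a : TP R n).
Hypothesis jI : j \notin I.
Hypothesis aI : pseudovertex v I j a.

(** A zero row at [j] pads the [n.-1] equations to a singular square matrix, and [f] is a kernel
    vector. Taking for [e] its least exponent relative to [a] keeps some leading coefficient
    non-zero; a change of sign settles [c j]. *)
Lemma pseudovertex_normal (tau : 'I_n -> 'I_p) : exists (f : 'rV[hahn R]_n) e c,
  [/\ f != 0, forall l, l != j -> \sum_i f 0 i * V (tau l) 0 i = 0,
      forall k, lead (f 0 k) (tcoord a k + e) (c k), exists k, c k != 0 &
      c j <= 0].
Proof.
pose A : 'M[hahn R]_n := \matrix_(l, i) if l == j then 0 else V (tau l) 0 i.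
have : \det A^T == 0.
  rewrite det_tr (expand_det_row _ j) big1// => i _.
  by rewrite mxE eqxx mul0r.
case/det0P => f f0 fA.
have fV l : l != j -> \sum_i f 0 i * V (tau l) 0 i = 0.
  move=> lj; move/rowP/(_ l): fA; rewrite !mxE => fl; rewrite -[RHS]fl.
  by apply: eq_bigr => i _; rewrite !mxE (negPf lj).
have [k0 fk0] := rV0Pn _ f0.
have [k fk kmin] := @arg_minP _ _ _ k0 [pred k | f 0 k != 0]
  (fun k => minexp (f 0 k) - tcoord a k) fk0.
set e := _ - _ in kmin; pose c l := f 0 l (tcoord a l + e).
have lf l : lead (f 0 l) (tcoord a l + e) (c l).
  split=> // b be; have [->|fl] := eqVneq (f 0 l) 0; first exact: hahn0E.
  have [_ ] := minexpP fl; apply; apply: lt_le_trans be _.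
  by have := kmin l fl; rewrite /e; lra.
have ck : c k != 0 by rewrite /c /e addrC subrK; case: (minexpP fk).
have [cj|/ltW cj] := leP (c j) 0.
  by exists f, e, c; split=> //; exists k.
exists (- f), e, (fun l => - c l); split=> //.
- by rewrite oppr_eq0.
- move=> l lj; transitivity (- \sum_i f 0 i * V (tau l) 0 i).
    by rewrite -sumrN; apply: eq_bigr => i _; rewrite mxE mulNr.
  by rewrite fV// oppr0.
- by move=> l; rewrite mxE; exact: leadN.
- by exists k; rewrite oppr_eq0.
- by rewrite oppr_le0.
Qed.

Lemma pseudovertex_facet : facet_images (cone V) (trop_halfspace a I).
Proof.
have [tau [par [parI parJ tauS nI]]] := pseudovertex_tree vgp vpure jI aI.
have [mu [d dP]] := lift_lead V0 Vv a.
have [f [e [c [f0 fV lf [k0 ck0] cj]]]] := pseudovertex_normal tau.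
have dpos r k : r \in trop_type v a k -> 0 < d r k.
  by move=> rk; have [_] := dP r k; rewrite rk.
have dzero r k : r \notin trop_type v a k -> d r k = 0.
  by move=> /negPf rk; have [_] := dP r k; rewrite rk => /eqP.
have ldot r : lead (\sum_i f 0 i * V r 0 i) (e + mu r) (\sum_k c k * d r k).
  apply: lead_sum => k _; have -> : e + mu r = tcoord a k + e + (mu r - tcoord a k).
    by ring.
  by apply: leadM => //; case: (dP r k).
have par_neq l : l != j -> par l != l.
  move=> lj; have [lI|lI] := boolP (l \in I); first by rewrite parI// eq_sym.
  by apply: contraTneq (parJ l lI lj) => ->.
(* The equation at [tau l] has two leading terms, indexed by [l] and [par l]. *)
have edge l : l != j -> exists2 q, 0 < q & c l = - (q * c (par l)).
  move=> lj; have pl := par_neq l lj.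
  have dl : 0 < d (tau l) l by apply: dpos; rewrite tauS// eqxx.
  have dp : 0 < d (tau l) (par l) by apply: dpos; rewrite tauS// eqxx orbT.
  exists (d (tau l) (par l) / d (tau l) l); first exact: divr_gt0.
  have := ldot (tau l); rewrite fV// => /(lead_uniq (lead0 _)).
  rewrite (bigD1 l)//= (bigD1 (par l))//= big1 => [|k /andP[kl kp]]; last first.
    by rewrite dzero ?mulr0// tauS// (negPf kl) (negPf kp).
  rewrite addr0 => /esym/eqP; rewrite addr_eq0 => /eqP h.
  apply: (mulIf (lt0r_neq0 dl)); rewrite h mulNr; congr (- _).
  by rewrite mulrAC divfK ?lt0r_neq0// mulrC.
(* If [c j] vanished, the edges would carry zero to the whole tree, against [c k0 != 0]. *)
have cj0 : c j < 0.
  rewrite lt_neqAle cj andbT; apply/eqP => cj'; move/eqP: ck0; apply.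
  have cI i : i \in I -> c i = 0.
    move=> iI; have [|q _ ->] := edge i; first by apply: contraNneq jI => <-.
    by rewrite parI// cj' mulr0 oppr0.
  have [/cI//|kI] := boolP (k0 \in I); have [->//|kj] := eqVneq k0 j.
  by have [q _ ->] := edge k0 kj; rewrite cI ?mulr0 ?oppr0//; exact: parJ.
have cI i : i \in I -> 0 < c i.
  move=> iI; have [|q q0 ->] := edge i; first by apply: contraNneq jI => <-.
  by rewrite parI// oppr_gt0 pmulr_rlt0.
have cJ k : k \notin I -> c k < 0.
  move=> kI; have [->//|kj] := eqVneq k j.
  have [q q0 ->] := edge k kj; rewrite oppr_lt0 pmulr_rgt0// cI//.
  exact: parJ.
have c_neq0 k : c k != 0.
  by have [/cI/lt0r_neq0//|/cJ/ltr0_neq0] := boolP (k \in I).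
have fpos r : (forall k, k \notin I -> r \notin trop_type v a k) ->
    0 < \sum_i f 0 i * V r 0 i.
  move=> rI; apply: lead_gt0 (ldot r) _.
  have [/setP/(_ r) + _ _] := aI; rewrite finset.in_setT => /bigcupP[i iI ri].
  rewrite (bigD1 i)//=; apply: ltr_wpDr; last by rewrite mulr_gt0 ?cI ?dpos.
  apply: sumr_ge0 => k _; have [rk|/dzero->] := boolP (r \in trop_type v a k).
    have kI : k \in I by apply: contraLR rk; exact: rI.
    by rewrite ltW// mulr_gt0 ?cI ?dpos.
  by rewrite mulr0.
have fr r : 0 < \sum_i f 0 i * V r 0 i \/ exists2 l, l != j & r = tau l.
  have [[k kI rk]|nk] := pselect (exists2 k, k \notin I & r \in trop_type v a k).
    by right; apply: (nI r k).
  by left; apply: fpos => k kI; apply/negP => rk; apply: nk; exists k.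
have Vf : cone V `<=` halfspace f.
  apply/cone_halfspaceP => r; have [/ltW//|[l lj ->]] := fr r.
  by rewrite fV.
(* Otherwise [l] and [m] are parents of each other; parents alternate between [I] and its
   complement, so one of them would be the root [j]. *)
have tau_inj l m : l != j -> m != j -> tau l = tau m -> l = m.
  move=> lj mj lm; apply/eqP; apply: contraT => nlm.
  have /eqP ml : m == par l.
    by have := tauS l m lj; rewrite lm tauS// eqxx /= [m == l]eq_sym (negPf nlm).
  have /eqP lm' : l == par m.
    by have := tauS m l mj; rewrite -lm tauS// eqxx /= (negPf nlm).
  have [lI|lI] := boolP (l \in I).
    by move: mj; rewrite ml parI ?eqxx.
  by move: (lj); rewrite lm' parI ?eqxx// ml; exact: parJ.
pose g (i : 'I_n.-1) := tau (lift j i).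
have lift_neq i : lift j i != j by rewrite eq_sym neq_lift.
have gi : injective g by move=> i k /tau_inj h; apply: (@lift_inj _ j); exact: h.
pose X := [tuple V (g i) | i < n.-1].
have XE (i : 'I_n.-1) : X`_i = V (g i) by rewrite nth_mktuple.
(* The minor on the coordinates other than [j] is non-zero; these generators therefore give the face
   dimension [n.-1]. *)
have Xfree : free X.
  apply/freeP => k kX.
  have dA := lift_minor_neq0 vgp V0 Vv (@lift_inj _ j) gi.
  have : \row_i k i = 0.
    apply/eqP; apply: contraT => k_neq0; exfalso.
    move: dA; rewrite -det_tr => /det0P; apply; exists (\row_i k i) => //.
    apply/rowP => i; move/rowP/(_ (lift j i)): kX; rewrite !mxE summxE => kX.
    rewrite -[RHS]kX; apply: eq_bigr => l _.
    by rewrite XE !mxE.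
  by move=> /rowP kE i; have := kE i; rewrite !mxE.
have hyp : val_image (halfspace f) = trop_halfspace a I.
  rewrite val_image_halfspace; first last.
  - by move=> k; exact: lead_neq0 (lf k) _.
  - exact: ltnW.
  congr trop_halfspace.
    rewrite -[RHS]toTP_tcoord; apply: (@toTP_shift _ _ _ _ (- e)) => i.
    by rewrite !mxE (minexp_lead (lf i))// addrK.
  apply/setP => i; rewrite inE; have [iI|iI] := boolP (i \in I).
    exact: lead_gt0 (lf i) (cI i iI).
  by apply/negbTE; rewrite -leNgt ltW// (lead_lt0 (lf i))// cJ.
exists (halfspace f) => //; exists f; split=> //; split; first by exists f.
exists <<X>>%VS; split.
- move=> x /(face_span Vf); apply: subvP; apply: sub_span => y /mapP[r].
  rewrite mem_enum inE => /eqP r0 ->; have [|[l lj ->]] := fr r.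
    by rewrite r0 ltxx.
  have [i|lj'] := unliftP j l; last by rewrite lj' eqxx in lj.
  by move=> ->; apply/mapP; exists i; rewrite ?mem_enum.
- move=> W FW; apply/span_subvP => y /mapP[i _ ->]; apply: FW.
  by split; [exact: cone_generator|exact: fV].
- by move/eqP: Xfree => ->; rewrite size_tuple.
Qed.

End PseudovertexFacet.

(** * Separation of outside points by pseudovertices *)

Section Separation.
Context {R : realType} {n p : nat} (v : 'I_p -> TP R n).
Hypothesis p1 : (1 <= p)%N.

Section FixedPoint.
Context (x : TP R n) (j : 'I_n).

(** The tropical half-space with apex [b] cut out by the coordinates in [I] and
    [j] only, normalised by [b j = tcoord x j], contains the generators but not
    [x]. *)
Definition separates (I : {set 'I_n}) (b : 'I_n -> R) :=
  [/\ j \notin I,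
      forall r, exists2 i, i \in I &
        tcoord (v r) j - tcoord x j <= tcoord (v r) i - b i &
      forall i, i \in I -> tcoord x i < b i].

(** [b i] cannot be increased while keeping the [r]-th generator. *)
Definition blocked (I : {set 'I_n}) (b : 'I_n -> R) (i : 'I_n) (r : 'I_p) :=
  tcoord (v r) i - b i = tcoord (v r) j - tcoord x j /\
  forall h, h \in I -> h != i -> tcoord (v r) h - b h < tcoord (v r) j - tcoord x j.

(** The indices are treated in turn. Minimality of [I] yields generators kept by [i] alone, and
    [b i] is raised until the first of them becomes tight. No entry decreases, so indices already
    blocked stay blocked. *)
Lemma ex_blocked (I : {set 'I_n}) (b : 'I_n -> R) : separates I b ->
  (forall i b', i \in I -> ~ separates (I :\ i) b') ->
  exists2 b', separates I b' & forall i, i \in I -> exists r, blocked I b' i r.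
Proof.
move=> Ib Imin; suff [b' Ib' bl] : exists2 b', separates I b' &
    forall i, i \in enum I -> exists r, blocked I b' i r.
  by exists b' => // i iI; apply: bl; rewrite mem_enum.
have : {subset enum I <= I} by move=> i; rewrite mem_enum.
elim: (enum I) => [|i s IH] sI; first by exists b.
have {IH} [|b1 [jI b1I b1x] bl] := IH; first by move=> h hs; rewrite sI// inE hs orbT.
have iI : i \in I by rewrite sI// mem_head.
pose Q := [pred r | [forall h in I, (h != i) ==>
  (tcoord (v r) h - b1 h < tcoord (v r) j - tcoord x j)]].
have QP r : Q r -> forall h, h \in I -> h != i ->
    tcoord (v r) h - b1 h < tcoord (v r) j - tcoord x j.
  by move=> /forall_inP Qr h hI hi; have /implyP := Qr h hI; apply.
have [r0 Qr0] : exists r, Q r.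
  apply: contrapT => nQ; apply: (Imin i b1 iI); split.
  - by rewrite !inE (negPf jI) andbF.
  - move=> r; have /negP : ~ Q r by move=> Qr; apply: nQ; exists r.
    rewrite negb_forall => /existsP[h]; rewrite !negb_imply -leNgt.
    by case/and3P => hI hi hr; exists h => //; rewrite !inE hi.
  - by move=> h; rewrite !inE => /andP[_]; exact: b1x.
have [r Qr rmin] := @arg_minP _ _ _ r0 Q
  (fun r => tcoord (v r) i - tcoord (v r) j) Qr0.
pose b2 l := if l == i then tcoord (v r) i - tcoord (v r) j + tcoord x j else b1 l.
have b2i : b2 i = tcoord (v r) i - tcoord (v r) j + tcoord x j by rewrite /b2 eqxx.
have b2n l : l != i -> b2 l = b1 l by rewrite /b2 => /negPf ->.
have b12 l : b1 l <= b2 l.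
  have [->|/b2n ->//] := eqVneq l i; have [h hI hr] := b1I r.
  have [hi|hi] := eqVneq h i; first by rewrite b2i; move: hr; rewrite hi; lra.
  by have := QP r Qr h hI hi; lra.
exists b2.
  split=> // [s'|h hI]; last by apply: lt_le_trans (b12 h); exact: b1x.
  have [Qs|] := boolP (Q s').
    by exists i => //; rewrite b2i; have := rmin _ Qs; lra.
  rewrite negb_forall => /existsP[h]; rewrite !negb_imply -leNgt.
  by case/and3P => hI hi hr; exists h => //; rewrite b2n.
move=> h; rewrite inE; have [-> _|hi /= /bl[q [qh qI]]] := eqVneq h i.
  exists r; split; first by rewrite b2i; lra.
  by move=> l lI li; rewrite b2n//; exact: QP.
exists q; split; first by rewrite b2n.
by move=> l lI lh; apply: le_lt_trans (qI l lI lh); rewrite lerD2l lerN2.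
Qed.

(** Blocking is the source of the third condition on pseudovertices: a generator tight at [i], at
    [j] and nowhere else in [I]. The inequality at [j] excludes [x], since [b] exceeds [x] on
    [I]. *)
Lemma blocked_pseudovertex (I : {set 'I_n}) (b : 'I_n -> R) : separates I b ->
  (forall i, i \in I -> exists r, blocked I b i r) ->
  exists a, [/\ nonempty_proper I, j \notin I, pseudovertex v I j a &
                ~ trop_halfspace a I x].
Proof.
move=> [jI bI bx] bl; have [i0 i0I _] := bI (Ordinal p1).
have /boolp.choice[M MP] : forall r, exists m,
    (forall i, i \in I -> tcoord (v r) i - b i <= m) /\
    exists2 i, i \in I & tcoord (v r) i - b i = m.
  move=> r; have [i iI im] := @arg_maxP _ _ _ i0 (mem I)
    (fun i => tcoord (v r) i - b i) i0I.
  by exists (tcoord (v r) i - b i); split => //; exists i.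
have /boolp.choice[q qP] k : exists q, forall r,
    tcoord (v r) k - M r <= tcoord (v q) k - M q.
  have [q _ qm] := @arg_maxP _ _ _ (Ordinal p1) xpredT
    (fun r => tcoord (v r) k - M r) isT.
  by exists q => r; exact: qm.
(* Outside [I] and [j], the least value keeping every generator below its level [M r]; the generator
   [q k] is tight there, which gives the second condition. *)
pose y k := if k \in I then b k else if k == j then tcoord x j else
  tcoord (v (q k)) k - M (q k).
have yI i : i \in I -> y i = b i by rewrite /y => ->.
have yj : y j = tcoord x j by rewrite /y (negPf jI) eqxx.
have yM r k : tcoord (v r) k - y k <= M r.
  have [leM _] := MP r; have [kI|kI] := boolP (k \in I).
    by rewrite yI//; exact: leM.
  have [->|kj] := eqVneq k j.
    by have [i iI] := bI r; rewrite yj; have := leM i iI; lra.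
  by rewrite /y (negPf kI) (negPf kj); have := qP k r; lra.
pose a := toTP (\row_k y k).
have [c ac] : exists c, forall k, tcoord a k = y k + c.
  by have [c h] := tcoord_toTP (\row_k y k); exists c => k; rewrite h mxE.
have typeE r k : (r \in trop_type v a k) = (tcoord (v r) k - y k == M r).
  apply/mem_trop_type/eqP => [rk|rk l].
    have [_ [i iI iM]] := MP r; apply/eqP; rewrite eq_le yM /=.
    by have := rk i; rewrite !ac yI//; lra.
  by have := yM r l; rewrite !ac; lra.
have blM i r : i \in I -> blocked I b i r ->
    [/\ r \in trop_type v a i, r \in trop_type v a j &
        forall h, h \in I -> h != i -> r \notin trop_type v a h].
  move=> iI [ri rI]; have rM : M r = tcoord (v r) j - tcoord x j.
    have [_ [h hI hM]] := MP r; have [hi|hi] := eqVneq h i.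
      by rewrite -hM hi.
    by have := yM r j; have := rI h hI hi; rewrite yj; lra.
  split; [by rewrite typeE yI// ri rM|by rewrite typeE yj rM|move=> h hI hi].
  by rewrite typeE yI// rM lt_eqF// rI.
exists a; split=> //.
- split; first by apply/set0Pn; exists i0.
  by apply: contraNneq jI => ->; rewrite finset.in_setT.
- split.
  + apply/setP => r; rewrite finset.in_setT; apply/bigcupP.
    have [_ [i iI iM]] := MP r; exists i => //.
    by rewrite typeE yI// iM.
  + move=> k kI; have [->|kj] := eqVneq k j.
      have [r /(blM _ _ i0I)[ri rj _]] := bl i0 i0I.
      by exists i0 => //; apply/set0Pn; exists r; rewrite inE ri.
    have [_ [i iI iM]] := MP (q k); exists i => //.
    apply/set0Pn; exists (q k); rewrite inE !typeE yI// iM eqxx /=.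
    by rewrite /y (negPf kI) (negPf kj) subKr.
  + move=> i iI; have [r /(blM _ _ iI)[ri rj rI]] := bl i iI.
    apply/subsetPn; exists r; first by rewrite inE ri.
    by apply/bigcupP => -[h] /setD1P[hi hI]; apply/negP; exact: rI.
- move=> /trop_halfspaceP/(_ j jI)[i iI].
  by have := bx i iI; rewrite !ac yj yI//; lra.
Qed.

End FixedPoint.

(** Some [j] has an empty type at [x], so every generator is strictly larger, relative to [x], in
    another coordinate. Raising [x] off [j] by the least such gap keeps all generators. *)
Lemma ex_separates (x : TP R n) : ~ trop_polytope v x ->
  exists j b, separates x j [set~ j]%SET b.
Proof.
move=> /trop_polytopeP nx; have [j jx] : exists j, forall r, r \notin trop_type v x j.
  apply: contrapT => nj; apply: nx => j; apply: contrapT => nr.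
  by apply: nj; exists j => r; apply/negP => rj; apply: nr; exists r.
have /boolp.choice[m mP] r : exists k,
    tcoord (v r) j - tcoord x j < tcoord (v r) k - tcoord x k.
  have := jx r; rewrite inE negb_forall => /existsP[k]; rewrite -ltNge.
  by exists k.
pose gap r := tcoord (v r) (m r) - tcoord x (m r) - (tcoord (v r) j - tcoord x j).
have [q _ qmin] := @arg_minP _ _ _ (Ordinal p1) xpredT gap isT.
exists j, (fun i => tcoord x i + gap q); split.
- by rewrite !inE eqxx.
- move=> r; exists (m r).
    by rewrite !inE; apply: contraTneq (mP r) => ->; rewrite ltxx.
  by have := qmin r isT; rewrite {2}/gap; lra.
- by move=> i _; rewrite ltrDl subr_gt0.
Qed.

(** A separating [I] of least cardinality has the minimality that [ex_blocked] requires. *)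
Lemma separation_by_pseudovertex (x : TP R n) : ~ trop_polytope v x ->
  exists I j a, [/\ nonempty_proper I, j \notin I, pseudovertex v I j a &
                    ~ trop_halfspace a I x].
Proof.
move=> /ex_separates[j [b0 b0P]].
have P0 : `[< exists b, separates x j [set~ j]%SET b >] by apply/asboolP; exists b0.
have [I /asboolP[b Ib] Imin] := @arg_minP _ _ _ [set~ j]%SET
  [pred I | `[< exists b, separates x j I b >]] (fun I : {set 'I_n} => #|I|) P0.
have [|b' Ib' bl] := ex_blocked Ib.
  move=> i b' iI Ib'; have : (#|I| <= #|I :\ i|)%N.
    by apply: Imin; apply/asboolP; exists b'.
  by rewrite [X in (X <= _)%N](cardsD1 i) iI ltnn.
by have [a aP] := blocked_pseudovertex Ib' bl; exists I, j, a.
Qed.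

End Separation.

Theorem theorem18 (R : realType) (n p : nat) (v : 'I_p -> TP R n) :
  (2 <= n)%N -> (1 <= p)%N -> injective v -> general_position v ->
  pure (trop_polytope v) ->
  forall C : set 'rV[hahn R]_n, is_lift v C ->
    external_representation (facet_images C) (trop_polytope v) /\
    (forall (I : {set 'I_n}) (j : 'I_n) (a : TP R n),
       nonempty_proper I -> j \notin I -> pseudovertex v I j a ->
       facet_images C (trop_halfspace a I)).
Proof.
move=> n2 p1 _ vgp vpure C [V [V0 Vv ->]].
have facet (I : {set 'I_n}) (j : 'I_n) (a : TP R n) : j \notin I -> pseudovertex v I j a ->
    facet_images (cone V) (trop_halfspace a I) by exact: pseudovertex_facet.
split; last by move=> I j a _; exact: facet.
split; first exact: (@finite_facet_images _ _ _ v).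
- move=> _ [H /facet_definingP[f [f0 -> _ nX]] <-].
  exact: (facet_image_halfspace n2 vgp V0 Vv).
(* The facet images coming from pseudovertices already exclude every point outside the polytope. *)
- rewrite eqEsubset; split=> [x xF|x xv _ [H /facet_definingP[f [_ -> Vf _]] <-]].
    apply: contrapT => /(separation_by_pseudovertex p1)[I [j [a [_ jI aI]]]].
    by apply; apply: xF; exact: facet aI.
  exact: (polytope_sub_val_image V0 Vv Vf).
Qed.
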